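(* Let $W=\sum_{i=1}^n\xi_i$, where $(\xi_i)_{i=1}^n$ is a sequence of $\mathbb{R}^d$-valued independent random vectors with $\mathbb{E}\{\xi_i\}=0$ for $1\le i\le n$ and $\sum_{i=1}^n\mathbb{E}\{\xi_i\xi_i^{\top}\}=I_d$. Let $\Delta_1$ and $\Delta_2$ be nonnegative random variables. Then for all $A\in\mathcal{A}$ such that $r(\bar A)>\gamma$, $$\mathbb{P}\bigl(W\in A^{4\gamma+\Delta_1}\setminus A^{4\gamma-\bar\Delta_2}\bigr)\le19\,d^{1/2}\gamma+2\,\mathbb{E}\bigl\{\|W\|(\Delta_1+\Delta_2)\bigr\}+2\sum_{i=1}^n\sum_{j=1}^2\mathbb{E}\bigl\{\|\xi_i\|\,|\Delta_j-\Delta_j^{(i)}|\bigr\},$$ where $\bar\Delta_2=\Delta_2\wedge(r(\bar A)-\gamma)$ and, for $j=1,2$ and each $i$, $\Delta_j^{(i)}$ is a random variable independent of $\xi_i$.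
   Context: $\mathcal{A}$ is the collection of all convex sets in $\mathbb{R}^d$, $\|\cdot\|$ the Euclidean norm, $\gamma=\sum_{i=1}^n\mathbb{E}\|\xi_i\|^3$, $a\wedge b=\min(a,b)$. For $A\subset\mathbb{R}^d$, $d(x,A)=\inf\{\|x-y\|:y\in A\}$; for $\varepsilon>0$, $A^{\varepsilon}=\{x\in\mathbb{R}^d:d(x,A)\le\varepsilon\}$ and $A^{-\varepsilon}=\{x\in A:B(x,\varepsilon)\subset A\}$, where $B(x,\varepsilon)$ is the $d$-dimensional ball centered at $x$ with radius $\varepsilon$; $A^0=A$. $\bar A$ is the closure of $A$ and $r(\bar A)=\max\{y:B(x,y)\subset\bar A\text{ for some }x\in\mathbb{R}^d\}$ is its inradius.
   Formalization: Independence of Δ_j^(i) and ξ_i is strengthened to independence of ξ_i from the pair (Δ_j^(i), W−ξ_i); with marginal independence alone the claim fails (d=1, ξ_i=±1/√n, Δ_1=Δ_1^(i)=|W|1{|W|≤1/2}, Δ_2=Δ_2^(i)=0, A=[−M,−4γ], M and n large). *)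

(* Defs.v *)
From HB Require Import structures.
From mathcomp Require Import all_boot all_order all_algebra.
From mathcomp Require Import all_classical all_reals all_analysis.

Set Implicit Arguments.
Unset Strict Implicit.
Unset Printing Implicit Defensive.

Import Order.TTheory GRing.Theory Num.Theory.
Import numFieldNormedType.Exports.

Local Open Scope classical_set_scope.
Local Open Scope ring_scope.

(* The norm `|x| of 'rV[R]_d in the library is the sup norm. *)
Definition enorm (R : realType) (d : nat) (x : 'rV[R]_d) : R :=
  Num.sqrt (\sum_(k < d) x ord0 k ^+ 2).

Definition eball (R : realType) (d : nat) (x : 'rV[R]_d) (e : R) :
  set 'rV[R]_d := [set y | enorm (x - y) <= e].

(* Extended-real valued, so that d(x, set0) = +oo. *)
Definition edist (R : realType) (d : nat) (x : 'rV[R]_d) (A : set 'rV[R]_d) :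
  \bar R := ereal_inf [set (enorm (x - y))%:E | y in A].

(* A^t for a real t of either sign. *)
Definition parallel_set (R : realType) (d : nat) (A : set 'rV[R]_d) (t : R) :
  set 'rV[R]_d :=
  if 0 < t then [set x | (edist x A <= t%:E)%E]
  else if t < 0 then [set x | A x /\ eball x (- t) `<=` A]
  else A.

(* A supremum in the extended reals: it is +oo when A contains arbitrarily
   large balls (e.g. half-spaces), and -oo when A is empty. *)
Definition inradius (R : realType) (d : nat) (A : set 'rV[R]_d) : \bar R :=
  ereal_sup [set y%:E | y in [set y : R | 0 <= y /\ exists x, eball x y `<=` A]].

(* 'rV[R]_d with its Borel sigma-algebra. *)
Notation borel_rV R d := (g_sigma_algebraType (@open 'rV[R]_d)).

Definition random_vector (disp : measure_display) (T : measurableType disp)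
    (R : realType) (d : nat) (X : T -> 'rV[R]_d) : Prop :=
  measurable_fun [set: T] (X : T -> borel_rV R d).

Definition mutually_independent (disp disp' : measure_display)
    (T : measurableType disp) (E : measurableType disp') (R : realType)
    (P : probability T R) (I : finType) (X : I -> T -> E) : Prop :=
  forall (J : {set I}) (B : I -> set E),
    (forall i, i \in J -> measurable (B i)) ->
    P (\bigcap_(i in [set` J]) (X i @^-1` B i)) =
    (\prod_(i in J) P (X i @^-1` B i))%E.

Definition independent2 (disp disp1 disp2 : measure_display)
    (T : measurableType disp) (E1 : measurableType disp1)
    (E2 : measurableType disp2) (R : realType) (P : probability T R)
    (X : T -> E1) (Y : T -> E2) : Prop :=
  forall (B1 : set E1) (B2 : set E2), measurable B1 -> measurable B2 ->
    P (X @^-1` B1 `&` Y @^-1` B2) = (P (X @^-1` B1) * P (Y @^-1` B2))%E.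

(* xi_i is independent of the leave-one-out pair (D, V), where D stands for
   Delta_j^(i) and V for W - xi_i.  Independence of D and xi_i alone does not
   suffice for the concentration inequality: with xi_i = +-1/sqrt n symmetric
   signs, D = |W| 1{|W| <= 1/2} is independent of each single xi_i. *)
Definition leave_one_out_independent (disp : measure_display)
    (T : measurableType disp) (R : realType) (P : probability T R) (d : nat)
    (D : T -> R) (V xi : T -> 'rV[R]_d) : Prop :=
  independent2 P (fun w => (D w, V w) : (R * borel_rV R d)%type)
                 (xi : T -> borel_rV R d).

(* Upper probability of an arbitrary event: it equals P on measurable sets
   (measurable_mu_extE).  It is needed because a convex set may fail to be
   Borel (the boundary of a ball can carry any subset), while the value of P
   on a nonmeasurable set is unconstrained. *)
Definition outer_prob (disp : measure_display) (T : measurableType disp)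
    (R : realType) (P : probability T R) (S : set T) : \bar R := mu_ext P S.

(* Main.v *)
(** The closed convex set is cut out, up to the slack [gamma], by countably many
    supporting half-spaces with unit normals [u j], so that the shell is a limit
    of sets on which [rho], a maximum of finitely many functions [u j . x - s j],
    takes values in a short random interval.  Let [n x] be the normal of an
    active half-space at [x].  Convexity of [rho] alone shows that for an
    increasing ramp [phi] of slope 1 near the shell, the field [f := phi(rho) n]
    is monotone and satisfies [v . (f x - f (x - v)) >= (n x . v) ^ 2] for [x] in
    the shell and [|v| <= 2 gamma]; neither differentiability of [rho] nor
    continuity of [n] is needed.  Summing over [v = xi i] bounds
    [W . f W - sum_i xi i . f (W - xi i)] from below by the quadratic form at
    [n W] of the truncated empirical covariance, whose mean is at least 1/2 and
    whose fluctuations are at most [2 gamma sqrt d].  From above, [|f|] is at most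
    [Delta1 + Delta2 + 7 gamma], and [xi i . f (W - xi i)] has mean 0 once
    [Delta_j] is replaced by [Delta_j^(i)], on which [f] depends additively and
    1-Lipschitz. *)
Require Import Defs.
From mathcomp Require Import all_boot all_order all_algebra.
From mathcomp Require Import all_classical all_reals all_analysis.
From HB Require Import structures.
From mathcomp Require Import measurable_realfun ring lra.
Import Order.TTheory GRing.Theory Num.Theory.
Import numFieldNormedType.Exports.
Local Open Scope classical_set_scope.
Local Open Scope ring_scope.

Set Implicit Arguments.
Unset Strict Implicit.
Unset Printing Implicit Defensive.

(** * Euclidean geometry *)

(** The direction [n W] depends on every [xi i], so no conditioning replaces the empirical
    covariance in that direction by its mean. The deviation is bounded in all unit directions at
    once by the Hilbert-Schmidt norm of the fluctuation matrix. Truncation at [e] gives this norm a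
    second moment, at most [e ^+ 2 * d], although only third moments of the [xi i] are available.
    With [e] = 2 gamma the truncation loses at most gamma / e = 1/2 of the covariance; the remaining
    1/2 is the source of the factors 2 in the bound. [Delta1i i] and [Delta2i i] are each assumed
    independent of [xi i] together with [W - xi i], but separately. Hence the ramp is written as a
    sum of two ramps, one for each Delta. The argument yields the constant 18 = 2 (2 + 7): 2 gamma
    sqrt d from the fluctuation, and 7 gamma E|W| with E|W| at most sqrt d, where 7 gamma is the
    slack gamma plus the length 3 [e] by which the ramps overshoot the shell. *)

Section euclidean.
Context {R : realType} {d : nat}.
Implicit Types x y z u v : 'rV[R]_d.

Definition dotv u v : R := \sum_(k < d) u ord0 k * v ord0 k.

Lemma dotvC u v : dotv u v = dotv v u.
Proof. by apply: eq_bigr => k _; rewrite mulrC. Qed.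

Lemma dotvDr u v w : dotv u (v + w) = dotv u v + dotv u w.
Proof. by rewrite -big_split; apply: eq_bigr => k _; rewrite mxE mulrDr. Qed.

Lemma dotvZr a u v : dotv u (a *: v) = a * dotv u v.
Proof. by rewrite mulr_sumr; apply: eq_bigr => k _; rewrite mxE mulrCA. Qed.

Lemma dotvNr u v : dotv u (- v) = - dotv u v.
Proof. by rewrite -scaleN1r dotvZr mulN1r. Qed.

Lemma dotvBr u v w : dotv u (v - w) = dotv u v - dotv u w.
Proof. by rewrite dotvDr dotvNr. Qed.

Lemma dotvDl u v w : dotv (v + w) u = dotv v u + dotv w u.
Proof. by rewrite !(dotvC _ u) dotvDr. Qed.

Lemma dotvBl u v w : dotv (v - w) u = dotv v u - dotv w u.
Proof. by rewrite !(dotvC _ u) dotvBr. Qed.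

Lemma dotvZl a u v : dotv (a *: v) u = a * dotv v u.
Proof. by rewrite !(dotvC _ u) dotvZr. Qed.

Lemma dotv0r u : dotv u 0 = 0.
Proof. by rewrite -[0](scale0r 0) dotvZr mul0r. Qed.

Lemma dotv_sumr I (s : seq I) (p : pred I) (F : I -> 'rV[R]_d) u :
  dotv u (\sum_(i <- s | p i) F i) = \sum_(i <- s | p i) dotv u (F i).
Proof. exact: (big_morph _ (dotvDr u) (dotv0r u)). Qed.

Lemma enorm_ge0 x : 0 <= enorm x.
Proof. exact: sqrtr_ge0. Qed.

Lemma enorm_sqr x : enorm x ^+ 2 = dotv x x.
Proof.
rewrite sqr_sqrtr; last by apply: sumr_ge0 => k _; exact: sqr_ge0.
by apply: eq_bigr => k _; rewrite expr2.
Qed.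

Lemma enormB_sqr u v :
  enorm (u - v) ^+ 2 = enorm u ^+ 2 - 2 * dotv u v + enorm v ^+ 2.
Proof. by rewrite !enorm_sqr !(dotvBl, dotvBr) (dotvC v u); ring. Qed.

Lemma dotv_le u v : dotv u v <= enorm u * enorm v.
Proof.
have h a b : 0 <= a ^+ 2 * enorm u ^+ 2 - 2 * (a * b * dotv u v)
    + b ^+ 2 * enorm v ^+ 2.
  have : 0 <= enorm (a *: u - b *: v) ^+ 2 by exact: sqr_ge0.
  rewrite enormB_sqr dotvZl dotvZr !enorm_sqr !(dotvZl, dotvZr).
  by lra.
have := enorm_ge0 u; rewrite le_eqVlt => /orP[/eqP u0|u0].
  (* With |u| = 0 these coefficients turn [h] into 0 <= - (2 + |v|^2) (u.v)^2, so u.v = 0. *)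
  have := h (1 + enorm v ^+ 2) (dotv u v); rewrite -u0 => h'.
  rewrite mul0r leNgt; apply/negP => p.
  have := sqr_ge0 (enorm v); nra.
have := enorm_ge0 v; rewrite le_eqVlt => /orP[/eqP v0|v0].
  have := h (dotv u v) (1 + enorm u ^+ 2); rewrite -v0 => h'.
  rewrite mulr0 leNgt; apply/negP => p.
  have := sqr_ge0 (enorm u); nra.
have {}h := h (enorm v) (enorm u).
by rewrite -(ler_pM2l (mulr_gt0 u0 v0)); lra.
Qed.

Lemma enormN x : enorm (- x) = enorm x.
Proof.
by rewrite /enorm; congr Num.sqrt; apply: eq_bigr => k _; rewrite mxE sqrrN.
Qed.

Lemma dotv_norm_le u v : `|dotv u v| <= enorm u * enorm v.
Proof.
rewrite ler_norml dotv_le andbT lerNl -dotvNr.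
by rewrite (le_trans (dotv_le _ _))// enormN.
Qed.

Lemma enormB x y : enorm (x - y) = enorm (y - x).
Proof. by rewrite -enormN opprB. Qed.

Lemma enormD x y : enorm (x + y) <= enorm x + enorm y.
Proof.
rewrite -(@ler_pXn2r _ 2) ?nnegrE ?addr_ge0 ?enorm_ge0//.
rewrite sqrrD !enorm_sqr !(dotvDl, dotvDr) (dotvC y x).
by have := dotv_le x y; lra.
Qed.

Lemma enorm_triangle x y z : enorm (x - z) <= enorm (x - y) + enorm (y - z).
Proof. by rewrite (le_trans _ (enormD _ _))// addrA subrK. Qed.

Lemma enormZ a x : enorm (a *: x) = `|a| * enorm x.
Proof.
apply/eqP; rewrite -(@eqrXn2 _ 2) ?mulr_ge0 ?enorm_ge0// exprMn !enorm_sqr.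
by rewrite dotvZl dotvZr mulrA -expr2 real_normK ?num_real.
Qed.

Lemma enorm0 : enorm (0 : 'rV[R]_d) = 0.
Proof. by rewrite -(scale0r 0) enormZ normr0 mul0r. Qed.

Lemma enorm_eq0 x : (enorm x == 0) = (x == 0).
Proof.
apply/eqP/eqP => [x0|->]; last exact: enorm0.
apply/rowP => k; rewrite mxE.
have : enorm x ^+ 2 = 0 by rewrite x0 expr0n.
rewrite enorm_sqr => /eqP; rewrite psumr_eq0; last first.
  by move=> i _; rewrite -expr2 sqr_ge0.
by move=> /allP/(_ k (mem_index_enum _)) /=; rewrite mulf_eq0 orbb => /eqP.
Qed.

Lemma norm_coord_le x k : `|x ord0 k| <= enorm x.
Proof.
rewrite -(@ler_pXn2r _ 2) ?nnegrE ?enorm_ge0// real_normK ?num_real//.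
rewrite enorm_sqr /dotv (bigD1 k)//= expr2 lerDl.
by apply: sumr_ge0 => i _; rewrite -expr2 sqr_ge0.
Qed.

Lemma enorm_le_sum x : enorm x <= \sum_(k < d) `|x ord0 k|.
Proof.
have s0 : 0 <= \sum_(k < d) `|x ord0 k| by exact: sumr_ge0.
rewrite -(@ler_pXn2r _ 2) ?nnegrE ?enorm_ge0// enorm_sqr expr2 mulr_suml.
apply: ler_sum => k _; rewrite (le_trans (ler_norm _))// normrM ler_wpM2l//.
by rewrite (bigD1 k)//= lerDl sumr_ge0.
Qed.

Lemma dotv_delta u k : dotv u (delta_mx ord0 k) = u ord0 k.
Proof.
rewrite /dotv (bigD1 k)//= mxE !eqxx mulr1 big1 ?addr0// => i ik.
by rewrite mxE (negbTE ik) mulr0.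
Qed.

Lemma enorm_delta (k : 'I_d) : enorm (delta_mx ord0 k : 'rV[R]_d) = 1.
Proof.
apply/eqP; rewrite -(@eqrXn2 _ 2) ?enorm_ge0// enorm_sqr dotv_delta mxE !eqxx.
by rewrite expr1n.
Qed.

End euclidean.

(** * Euclidean neighbourhoods and closest points *)

Section euclidean_topology.
Context {R : realType} {d : nat}.
Implicit Types (x y z u : 'rV[R]_d) (A B K : set 'rV[R]_d).

Lemma nbhs_enormP x B :
  nbhs x B <-> exists2 e, 0 < e & forall y, enorm (y - x) < e -> B y.
Proof.
split.
- move=> /nbhs_ballP[e /= e0 eB]; exists e => // y xy; apply: eB.
  split=> // i j; rewrite (ord1 i) -ball_normE /=.
  apply: le_lt_trans xy; rewrite distrC.
  by have := norm_coord_le (y - x) j; rewrite !mxE.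
- move=> [e e0 eB]; apply/nbhs_ballP.
  have e1 : 0 < e / d.+1%:R by rewrite divr_gt0.
  exists (e / d.+1%:R) => //= y [_ xy]; apply: eB.
  apply: (le_lt_trans (enorm_le_sum _)).
  have : \sum_(k < d) `|(y - x) ord0 k| <= \sum_(k < d) e / d.+1%:R.
    apply: ler_sum => k _; rewrite !mxE.
    by have := xy ord0 k; rewrite -ball_normE /= distrC => /ltW.
  move=> /le_lt_trans; apply.
  rewrite sumr_const card_ord -[X in X < _]mulr_natr -mulrA gtr_pMr// ltr_pdivrMl//.
  by rewrite mulr1 ltr_nat.
Qed.

Lemma closure_enormP A x :
  closure A x <-> forall e, 0 < e -> exists2 a, A a & enorm (a - x) < e.
Proof.
split=> [Ax e e0|Ax B /nbhs_enormP[e e0 eB]].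
- have /Ax[a [Aa xa]] : nbhs x [set y | enorm (y - x) < e].
    by apply/nbhs_enormP; exists e.
  by exists a.
- by have [a Aa /eB Ba] := Ax e e0; exists a.
Qed.

Lemma enorm_continuous x : continuous (fun y => enorm (x - y)).
Proof.
move=> y; apply: (iffRL (@cvgrPdist_lt _ R^o _ (nbhs y) (nbhs_filter y) _ _)).
move=> e e0; apply/nbhs_enormP; exists e => // z yz.
rewrite /= ltr_norml; apply/andP; split.
- have := enorm_triangle x y z; rewrite (enormB y z); lra.
- have := enorm_triangle x z y; lra.
Qed.

Lemma exists_closest_point A x : A !=set0 ->
  exists2 p, closure A p & forall a, closure A a -> enorm (x - p) <= enorm (x - a).
Proof.
move=> [a0 Aa0].
pose K := closure A `&` [set y | enorm (x - y) <= enorm (x - a0)].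
have K0 : K !=set0 by exists a0; split; [exact: subset_closure|exact: lexx].
have cK : compact K.
  apply: bounded_closed_compact.
  - exists (enorm x + enorm (x - a0)); split; first exact: num_real.
    move=> M ltM y [_ /= xy]; apply/(@ltW _ R); apply: le_lt_trans ltM.
    have yle : enorm y <= enorm x + enorm (x - a0).
      have := enorm_triangle y x 0; rewrite !subr0 (enormB y x); lra.
    apply: le_trans yle.
    change (mx_norm y <= enorm y).
    have [->|] := eqVneq (mx_norm y) 0; first exact: enorm_ge0.
    by move=> /mx_norm_neq0[[i j] ->] /=; rewrite (ord1 i) norm_coord_le.
  - apply: closedI; first exact: closed_closure.
    apply: (@preimage_closed _ R (fun y => enorm (x - y))
      [set t | t <= enorm (x - a0)]); last exact: closed_le.
    by move=> y _; exact: enorm_continuous.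
have [|p] := @EVT_min_rV R d (fun y => enorm (x - y)) K K0 cK.
  by apply: continuous_subspaceT; exact: enorm_continuous.
rewrite inE => -[clp xp] pmin; exists p => // a cla.
have [xa|/ltW xa] := leP (enorm (x - a)) (enorm (x - a0)).
  by apply: pmin; rewrite inE.
exact: le_trans xp xa.
Qed.

Lemma convex_setP A : convex_set A ->
  forall a b t, A a -> A b -> 0 <= t <= 1 -> A (t *: a + (1 - t) *: b).
Proof.
move=> cA a b t Aa Ab t01.
have /andP[t0 t1] := t01.
by have /set_mem := cA a b (Itv01 t0 t1) (mem_set Aa) (mem_set Ab).
Qed.

Lemma closest_point_dotv_le0 A x p : convex_set A -> closure A p ->
    (forall a, closure A a -> enorm (x - p) <= enorm (x - a)) ->
  forall a, A a -> dotv (x - p) (a - p) <= 0.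
Proof.
move=> cA clp pmin a Aa.
have clseg t : 0 <= t <= 1 -> closure A (t *: a + (1 - t) *: p).
  move=> t01; apply/closure_enormP => e e0.
  have [b Ab bp] := (closure_enormP A p).1 clp e e0.
  exists (t *: a + (1 - t) *: b); first exact: convex_setP.
  have -> : t *: a + (1 - t) *: b - (t *: a + (1 - t) *: p) = (1 - t) *: (b - p).
    by rewrite opprD addrACA subrr add0r -scalerBr.
  rewrite enormZ ger0_norm ?subr_ge0; last by case/andP: t01.
  apply: le_lt_trans bp; rewrite ler_piMl ?enorm_ge0//; lra.
rewrite leNgt; apply/negP => h.
set s := dotv (x - p) (a - p) in h.
set q := enorm (a - p) ^+ 2.
have q0 : 0 <= q by exact: sqr_ge0.
(* A move from [p] towards [a] by the fraction [t] changes the squared distance to [x] by t^2 q - 2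
   t s, which is negative since t q < s. The denominator also ensures t < 1. *)
pose t := s / (1 + q + s).
have D0 : 0 < 1 + q + s by lra.
have t0 : 0 < t by rewrite divr_gt0.
have t1 : t < 1 by rewrite /t ltr_pdivrMr//; lra.
have tD : t * (1 + q + s) = s by rewrite /t divfK// gt_eqF.
have /pmin : closure A (t *: a + (1 - t) *: p) by apply: clseg; lra.
have -> : x - (t *: a + (1 - t) *: p) = (x - p) - t *: (a - p).
  by apply/rowP => k; rewrite !mxE; ring.
rewrite -(@ler_pXn2r _ 2) ?nnegrE ?enorm_ge0// leNgt => /negP; apply.
rewrite enormB_sqr dotvZr enorm_sqr enorm_sqr dotvZl dotvZr -!enorm_sqr.
rewrite -/s -/q.
have : t * q < s by nra.
nra.
Qed.

End euclidean_topology.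

(** * Half-spaces around a convex set *)

Section separation.
Context {R : realType} {d : nat}.
Implicit Types (x y z u : 'rV[R]_d) (A K : set 'rV[R]_d).

Lemma exists_between_seq (s : seq R) (b : R) : {in s, forall r, r < b} ->
  exists2 t, t < b & {in s, forall r, r < t}.
Proof.
elim: s => [_|a s IH sb]; first by exists (b - 1) => //; lra.
have [|t tb st] := IH; first by move=> r rs; apply: sb; rewrite inE rs orbT.
have ab : a < b by apply: sb; exact: mem_head.
exists (Num.max t ((a + b) / 2)); first by rewrite gt_max tb /=; lra.
move=> r; rewrite inE lt_max => /orP[/eqP ->|/st -> //].
by apply/orP; right; lra.
Qed.

Lemma exists_gt_seq (s : seq R) : exists b, {in s, forall r, r < b}.
Proof.
elim: s => [|a s [b sb]]; first by exists 0.
exists (Num.max b (a + 1)) => r; rewrite inE lt_max => /orP[/eqP ->|/sb -> //].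
by apply/orP; right; lra.
Qed.

(* Fourier-Motzkin elimination of the head [a] of the list: if [u] is positive
   on the tail but not at [a], the induction hypothesis is applied to the
   points of the cone that [u] annihilates on the segments from [a] to the
   tail. *)
Lemma finite_cone_separation K (s : seq 'rV[R]_d) :
    (forall x y, K x -> K y -> K (x + y)) ->
    (forall t x, 0 < t -> K x -> K (t *: x)) -> ~ K 0 ->
    {in s, forall a, K a} ->
  exists u, {in s, forall a, 0 < dotv u a}.
Proof.
move=> KD KZ K0.
have [n] := ubnP (size s); elim: n s => // n IH [_ _|a s]; first by exists 0.
rewrite /= ltnS => sn sK.
have Ka : K a by apply: sK; exact: mem_head.
have sK' : {in s, forall b, K b} by move=> b bs; apply: sK; rewrite inE bs orbT.
have [u su] := IH s sn sK'.
have [ua|ua] := ltP 0 (dotv u a).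
  by exists u => b; rewrite inE => /orP[/eqP ->//|]; exact: su.
pose c := - dotv u a.
have c0 : 0 <= c by rewrite /c; lra.
pose f b := c *: b + dotv u b *: a.
have [||w sw] := IH (map f s); first by rewrite size_map.
  move=> _ /mapP[b bs ->]; rewrite /f.
  have Kua : K (dotv u b *: a) by apply: KZ => //; exact: su.
  move: c0; rewrite le_eqVlt => /orP[/eqP <-|c0].
    by rewrite scale0r add0r.
  by apply: KD => //; apply: KZ => //; exact: sK'.
have {}sw b : b \in s -> 0 < c * dotv w b + dotv u b * dotv w a.
  by move=> bs; have := sw _ (map_f f bs); rewrite /f dotvDr !dotvZr.
case: s => [|b0 s'] in sn sK sK' su sw *.
  exists a => b; rewrite inE => /eqP ->.
  rewrite -enorm_sqr exprn_gt0// lt_neqAle enorm_ge0 andbT eq_sym enorm_eq0.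
  by apply/eqP => a0; apply: K0; rewrite -a0.
set s := b0 :: s' in sn sK sK' su sw *.
pose g b := - dotv w b / dotv u b.
(* Positivity of [w + t *: u] on the tail bounds [t] from below by the [g b]. For c > 0, positivity
   at [a] bounds it from above by w.a / c, and [sw] says that these bounds are compatible. For c = 0
   there is no upper bound, and [sw] at [b0] gives w.a > 0. *)
have [t ta st] : exists2 t, 0 < dotv w a + t * dotv u a
    & {in s, forall b, g b < t}.
  move: c0; rewrite le_eqVlt => /orP[/eqP c0|c0].
  - have [t st] := exists_gt_seq (map g s).
    exists t; last by move=> b bs; apply: st; exact: map_f.
    have bs : b0 \in s by exact: mem_head.
    have := sw _ bs; have := su _ bs.
    rewrite -c0 mul0r add0r => ub; rewrite (pmulr_rgt0 _ ub) => wa.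
    have -> : dotv u a = 0 by rewrite /c in c0; lra.
    by rewrite mulr0 addr0.
  - have [|t tb st] := @exists_between_seq (map g s) (dotv w a / c).
      move=> _ /mapP[b bs ->]; rewrite /g.
      rewrite ltr_pdivrMr ?su// mulrAC ltr_pdivlMr//.
      by have := sw _ bs; lra.
    exists t; last by move=> b bs; apply: st; exact: map_f.
    by move: tb; rewrite ltr_pdivlMr// /c; lra.
exists (w + t *: u) => b; rewrite inE dotvDl dotvZl => /orP[/eqP -> //|bs].
by have := st b bs; rewrite /g ltr_pdivrMr ?su//; lra.
Qed.

(** If [z] were outside [A], the convex cone spanned by [A - z] would miss 0. Points of [A] close to
    z and to z +- (e/2) e_k would then lie strictly on one side of some [u], whereas [u] is clearly
    negative on one of each pair of opposite coordinate directions. Finitely many points suffice, so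
    the elementary separation above replaces Hahn-Banach. *)
Lemma interior_closure_convex A z e : convex_set A -> 0 < e ->
  (forall y, enorm (y - z) < e -> closure A y) -> A z.
Proof.
move=> cA e0 eA; apply: contrapT => nAz.
pose K : set 'rV[R]_d := [set x | exists t a, [/\ 0 < t, A a & x = t *: (a - z)]].
have KZ t x : 0 < t -> K x -> K (t *: x).
  move=> t0 [r [a [r0 Aa ->]]]; exists (t * r), a; split=> //.
    exact: mulr_gt0.
  by rewrite scalerA.
have KD x y : K x -> K y -> K (x + y).
  move=> [r [a [r0 Aa ->]]] [t [b [t0 Ab ->]]].
  have rt0 : 0 < r + t by rewrite addr_gt0.
  exists (r + t), ((r / (r + t)) *: a + (1 - r / (r + t)) *: b); split=> //.
    apply: convex_setP => //; apply/andP; split; first by rewrite divr_ge0// ltW.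
    by rewrite ler_pdivrMr// mul1r lerDl ltW.
  by apply/rowP => k; rewrite !mxE; field; rewrite gt_eqF.
have K0 : ~ K 0.
  move=> [t [a [t0 Aa /esym/eqP]]]; rewrite scaler_eq0 gt_eqF//= subr_eq0.
  by move=> /eqP az; apply: nAz; rewrite -az.
(* The d coordinate inequalities add up to (e/2)|u| <= d r |u|; the factor d + 1 makes e/2 = (d + 1)
   r, which leaves r |u| <= 0. *)
pose r := e / (2 * d.+1%:R).
have r0 : 0 < r by rewrite divr_gt0// mulr_gt0.
have near y : enorm (y - z) < e -> exists2 a, A a & enorm (a - y) < r.
  by move=> /eA/closure_enormP/(_ r r0).
have e2 : e / 2 < e by lra.
(* This point supplies 0 < u.(a0 - z) <= |u| r, the final contradiction, also in dimension 0 where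
   there are no coordinate directions. *)
have [a0 Aa0 a0z] : exists2 a, A a & enorm (a - z) < r.
  by apply: near; rewrite subrr enorm0.
pose v (kb : 'I_d * bool) : 'rV[R]_d :=
  ((-1) ^+ kb.2 * (e / 2)) *: delta_mx ord0 kb.1.
have /choice[p pP] kb : exists a, A a /\ enorm (a - (z + v kb)) < r.
  have [|a Aa ak] := near (z + v kb); last by exists a.
  rewrite addrAC subrr add0r enormZ enorm_delta mulr1 normrM normr_sign mul1r.
  by rewrite ger0_norm ?divr_ge0// ltW.
have [|u su] := finite_cone_separation (K := K)
    (s := (a0 - z) :: [seq p kb - z | kb : 'I_d * bool]) KD KZ K0.
  have KA a : A a -> K (a - z) by exists 1, a; rewrite scale1r.
  move=> x; rewrite inE => /orP[/eqP ->|/mapP[kb _ ->]]; first exact: KA.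
  by apply: KA; case: (pP kb).
have ua0 : 0 < dotv u (a0 - z) by apply: su; exact: mem_head.
have u_r x : enorm x < r -> dotv u x <= enorm u * r.
  move=> xr; apply: le_trans (dotv_le _ _) _.
  by rewrite ler_wpM2l ?enorm_ge0// ltW.
have uk k : e / 2 * `|u ord0 k| <= enorm u * r.
  (* The value true stands for the minus sign, so [v kb] points against the sign of [u ord0 k]. *)
  pose kb := (k, 0 < u ord0 k).
  have : 0 < dotv u (p kb - z).
    apply: su; rewrite inE; apply/orP; right.
    by apply/mapP; exists kb; rewrite ?mem_enum.
  have -> : p kb - z = (p kb - (z + v kb)) + v kb by rewrite opprD addrA subrK.
  rewrite dotvDr; have [_ /u_r] := pP kb.
  rewrite [in dotv u (v kb)]/v /= dotvZr dotv_delta.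
  have -> : (-1) ^+ (0 < u ord0 k)%R * (e / 2) * u ord0 k = - (e / 2 * `|u ord0 k|).
    by case: ltP => u0 /=; [rewrite gtr0_norm|rewrite ler0_norm]; rewrite //; ring.
  lra.
have := u_r _ a0z.
have : e / 2 * enorm u <= d%:R * (enorm u * r).
  apply: (@le_trans _ _ (e / 2 * \sum_(k < d) `|u ord0 k|)).
    by rewrite ler_pM2l ?divr_gt0// enorm_le_sum.
  have -> : d%:R * (enorm u * r) = \sum_(k < d) enorm u * r.
    by rewrite sumr_const card_ord mulr_natl.
  by rewrite mulr_sumr; exact: ler_sum.
have E : e / 2 = r * d.+1%:R by rewrite /r invfM mulrA divfK.
rewrite E -natr1; lra.
Qed.

(** The normal is the unit vector from the projection [p] of [y] on the closure to [y]. The last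
    clause says that the half-space is as far from [y] as [A] is, phrased by lower bounds [r] to
    avoid an infimum. *)
Lemma exists_supporting_halfspace A y : convex_set A -> A !=set0 ->
    ~ closure A y ->
  exists us : 'rV[R]_d * R, [/\ enorm us.1 = 1,
    forall a, A a -> dotv us.1 a <= us.2 &
    forall r, (forall a, A a -> r <= enorm (y - a)) -> r <= dotv us.1 y - us.2].
Proof.
move=> cA A0 nAy.
have [p clp pmin] := exists_closest_point y A0.
have py : 0 < enorm (y - p).
  rewrite lt_neqAle enorm_ge0 andbT eq_sym enorm_eq0 subr_eq0.
  by apply/eqP => yp; apply: nAy; rewrite yp.
pose u := (enorm (y - p))^-1 *: (y - p).
exists (u, dotv u p); split => /=.
- by rewrite enormZ ger0_norm ?invr_ge0 ?enorm_ge0// mulVf// gt_eqF.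
- move=> a Aa; rewrite -subr_le0 -dotvBr dotvZl pmulr_rle0 ?invr_gt0//.
  exact: closest_point_dotv_le0 clp pmin _ Aa.
- move=> r rA; rewrite -dotvBr dotvZl -enorm_sqr expr2 mulKf ?gt_eqF//.
  apply/ler_addgt0Pr => e e0; have [a Aa ap] := (closure_enormP A p).1 clp e e0.
  have := rA a Aa; have := enorm_triangle y p a; rewrite (enormB p a); lra.
Qed.

(** An enumeration of the rational points; codes that decode to nothing give the origin. *)
Definition rat_point (j : nat) : 'rV[R]_d :=
  map_mx ratr (odflt 0 (unpickle j : option 'rV[rat]_d)).

Lemma rat_point_dense y e : 0 < e -> exists j, enorm (rat_point j - y) < e.
Proof.
move=> e0; pose h := e / d.+1%:R.
have h0 : 0 < h by rewrite divr_gt0.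
have /choice[q qP] (k : 'I_d) : exists q : rat, `|ratr q - y ord0 k| < h.
  have [q] : exists q, ratr q \in `](y ord0 k), (y ord0 k + h)[.
    by apply: rat_in_itvoo; rewrite ltrDl.
  by rewrite in_itv/= => yq; exists q; rewrite ltr_norml; lra.
exists (pickle (\row_k q k)); rewrite /rat_point pickleK /=.
apply: (le_lt_trans (enorm_le_sum _)).
apply: (@le_lt_trans _ _ (\sum_(k < d) h)).
  by apply: ler_sum => k _; rewrite !mxE; exact/ltW/qP.
rewrite sumr_const card_ord -[X in X < _]mulr_natr /h -mulrA gtr_pMr//.
by rewrite ltr_pdivrMl// mulr1 ltr_nat.
Qed.

(** [A] need not be closed, so a point outside [A] may lie in the closure and have no separating
    half-space of its own; a nearby exterior point does. *)
Lemma nonmember_near_exterior A z e : convex_set A -> 0 < e -> ~ A z ->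
  exists2 y, enorm (y - z) < e & ~ closure A y.
Proof.
move=> cA e0; apply: contra_notP => /forall2NP h.
apply: (interior_closure_convex cA e0) => y yz.
by have [//|/contrapT] := h y.
Qed.

Lemma exterior_rat_point A y e : 0 < e -> ~ closure A y ->
  exists2 j, enorm (rat_point j - y) < e & ~ closure A (rat_point j).
Proof.
move=> e0 nAy; have /nbhs_enormP[r r0 rA] : nbhs y (~` closure A).
  by apply: open_nbhs_nbhs; split=> //; exact/closed_openC/closed_closure.
have [|j jy] := @rat_point_dense y (Num.min e r); first by rewrite lt_min e0.
rewrite lt_min in jy; have /andP[je jr] := jy.
exact: (ex_intro2 _ _ j je (rA _ jr)).
Qed.

(* The slack [e] allows the use of countably many half-spaces, the supporting
   ones at the rational points of the exterior. *)
Lemma exists_halfspace_family A e : convex_set A -> A !=set0 -> A != setT ->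
    0 < e ->
  exists (u : nat -> 'rV[R]_d) (s : nat -> R), [/\ forall j, enorm (u j) = 1,
    forall j a, A a -> dotv (u j) a <= s j &
    forall x t, ~ parallel_set A t x -> exists j, t - e <= dotv (u j) x - s j].
Proof.
move=> cA A0 AT e0.
have [z nAz] : exists z, ~ A z.
  apply: contrapT => /forallNP h; case/eqP: AT; rewrite -subTset => z _.
  by apply: contrapT; exact: h.
have e20 : 0 < e / 2 by lra.
have [y0 _ ny0] := nonmember_near_exterior cA e0 nAz.
(* Rational points of the closure are replaced by one fixed exterior point, so that every index
   carries a half-space. *)
pose Y j := if rat_point j \in closure A then y0 else rat_point j.
have nY j : ~ closure A (Y j) by rewrite /Y; case: ifPn => // /negP; rewrite inE.
have YE j : ~ closure A (rat_point j) -> Y j = rat_point j.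
  by move=> h; rewrite /Y ifF//; apply/negbTE/negP; rewrite inE.
have /choice[us usP] j := exists_supporting_halfspace cA A0 (nY j).
have dot_le j x y : dotv (us j).1 y - enorm (x - y) <= dotv (us j).1 x.
  have [u1 _ _] := usP j.
  by have := dotv_le (us j).1 (y - x); rewrite u1 mul1r dotvBr (enormB y x); lra.
exists (fun j => (us j).1), (fun j => (us j).2); split.
- by move=> j; case: (usP j).
- by move=> j; case: (usP j).
(* The case t <= 0: an exterior rational point within [e] of [w] has signed distance at least 0 to
   its half-space, and signed distances are 1-Lipschitz, so at [x] at most -t + e is lost. *)
have far x w t : enorm (x - w) <= - t -> ~ A w ->
    exists j, t - e <= dotv (us j).1 x - (us j).2.
  move=> xw nAw.
  have [y yw nAy] := nonmember_near_exterior cA e20 nAw.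
  have [j jy nAj] := exterior_rat_point e20 nAy; exists j.
  have [_ _ /(_ 0)] := usP j; rewrite YE// => h.
  have {}h := h (fun a _ => enorm_ge0 _).
  have := dot_le j x (rat_point j).
  have := enorm_triangle x w (rat_point j).
  have := enorm_triangle w y (rat_point j).
  rewrite (enormB w y) (enormB y (rat_point j)); lra.
move=> x t; rewrite /parallel_set; case: ifPn => [t0|t0].
- move=> /= /negP; rewrite -ltNge => tx.
  have dx a : A a -> t <= enorm (x - a).
    move=> Aa; rewrite -lee_fin; apply/ltW/(lt_le_trans tx).
    by apply: ereal_inf_lbound; exists a.
  (* Being closer than [t] to [x] keeps the rational point out of the closure. The accuracy e/2 is
     paid twice: in its distance to [A], and in the return to [x]. *)
  have [|j] := @rat_point_dense x (Num.min (e / 2) t); first by rewrite lt_min e20.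
  rewrite lt_min => /andP[je jt]; exists j.
  have nAj : ~ closure A (rat_point j).
    move=> /closure_enormP/(_ (t - enorm (rat_point j - x))).
    rewrite subr_gt0 => /(_ jt)[a /dx xa aj].
    have := enorm_triangle x (rat_point j) a.
    rewrite (enormB x (rat_point j)) (enormB (rat_point j) a); lra.
  have [_ _ /(_ (t - e / 2))] := usP j; rewrite YE// => h.
  have {}h : t - e / 2 <= dotv (us j).1 (rat_point j) - (us j).2.
    apply: h => a /dx.
    have := enorm_triangle x (rat_point j) a.
    rewrite (enormB x (rat_point j)); lra.
  have := dot_le j x (rat_point j); rewrite (enormB x (rat_point j)); lra.
- case: ifPn => [t1|t1].
  + move=> /= /not_andP[nAx|].
      by apply: (far x x) => //; rewrite subrr enorm0; lra.
    by move=> /existsNP[w /not_implyP[xw nAw]]; exact: (far x w).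
  + by move=> nAx; apply: (far x x) => //; rewrite subrr enorm0; lra.
Qed.

Lemma dotv_le_parallel_set A t x u s : enorm u = 1 ->
    (forall a, A a -> dotv u a <= s) -> 0 < t -> parallel_set A t x ->
  dotv u x - s <= t.
Proof.
move=> u1 us t0; rewrite /parallel_set t0 /= -lee_fin; apply: le_trans.
apply: le_ereal_inf_tmp => _ [a Aa <-]; rewrite lee_fin.
have := dotv_le u (x - a); rewrite u1 mul1r dotvBr.
by have := us a Aa; lra.
Qed.

End separation.

(** * A monotone field across the shell *)

Section polyhedral_max.
Context {R : realType} {d : nat}.
Variables (u : nat -> 'rV[R]_d) (s : nat -> R).
Implicit Types (x y v : 'rV[R]_d) (j k : nat).

Definition affine_form j x : R := dotv (u j) x - s j.

(** Value and active normal are computed together. The strict test gives ties to the smallest index,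
    which makes the selected normal a measurable function of [x]. *)
Fixpoint affine_argmax k x : R * 'rV[R]_d :=
  if k is k'.+1 then
    let p := affine_argmax k' x in
    if p.1 < affine_form k x then (affine_form k x, u k) else p
  else (affine_form 0 x, u 0).

Definition affine_max k x := (affine_argmax k x).1.

Definition affine_grad k x := (affine_argmax k x).2.

Lemma affine_argmaxE k x : exists2 j, (j <= k)%N &
  affine_argmax k x = (affine_form j x, u j).
Proof.
elim: k => [|k [j jk IH]] /=; first by exists 0%N.
by case: ifP => _; [exists k.+1|exists j => //; exact: leqW].
Qed.

Lemma affine_maxS k x : affine_max k x <= affine_max k.+1 x.
Proof. by rewrite /affine_max /=; case: ifP => [/ltW|]. Qed.

Lemma affine_max_homo j k x : (j <= k)%N -> affine_max j x <= affine_max k x.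
Proof.
by move=> jk; rewrite -(subnKC jk); elim: (k - j)%N => [|i IH];
  rewrite ?addn0// addnS (le_trans IH)// affine_maxS.
Qed.

Lemma le_affine_max j k x : (j <= k)%N -> affine_form j x <= affine_max k x.
Proof.
move=> jk; apply: le_trans (affine_max_homo x jk).
by case: j jk => //= j _; rewrite /affine_max /=; case: ltP.
Qed.

Lemma affine_max_le k x t :
  (forall j, affine_form j x <= t) -> affine_max k x <= t.
Proof.
by move=> xt; rewrite /affine_max; have [j _ ->] := affine_argmaxE k x; exact: xt.
Qed.

Hypothesis u1 : forall j, enorm (u j) = 1.

Lemma enorm_affine_grad k x : enorm (affine_grad k x) = 1.
Proof.
by rewrite /affine_grad; have [j _ ->] := affine_argmaxE k x; exact: u1.
Qed.

(** The subgradient inequality: the form active at [y] lies below the maximum everywhere and touches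
    it at [y]. *)
Lemma affine_grad_ge k x y :
  dotv (affine_grad k y) (x - y) <= affine_max k x - affine_max k y.
Proof.
rewrite /affine_grad [affine_max k y]/affine_max.
have [j jk -> /=] := affine_argmaxE k y.
by have := le_affine_max x jk; rewrite /affine_form dotvBr; lra.
Qed.

End polyhedral_max.

Section ramp.
Context {R : realType}.
Implicit Types L r t : R.

Definition ramp L r : R := Num.min (Num.max r 0) L.

Lemma ramp_ge0 L r : 0 <= L -> 0 <= ramp L r.
Proof. by move=> L0; rewrite /ramp le_min L0 andbT le_max lexx orbT. Qed.

Lemma ramp_le L r : ramp L r <= L.
Proof. by rewrite /ramp ge_min lexx orbT. Qed.

Lemma ramp_homo L : {homo ramp L : r r' / r <= r'}.
Proof.
move=> r r' rr'; rewrite /ramp; case: (leP r 0) => r0; case: (leP r' 0) => r'0;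
  by rewrite /Num.min; case: ltP => ?; case: ltP => ?; lra.
Qed.

Lemma ramp_lip L L' r : `|ramp L r - ramp L' r| <= `|L - L'|.
Proof.
rewrite /ramp; case: (leP r 0) => r0; rewrite /Num.min;
  by case: ltP => ?; case: ltP => ?; have := ler_norm (L - L');
  have := ler_norm (L' - L); rewrite (distrC L' L) ler_norml; lra.
Qed.

(** For L >= 0, ramp L (r + L) equals max 0 (L + min r 0), which is 1-Lipschitz in L although L
    occurs twice. *)
Lemma ramp_shift_lip L L' r : 0 <= L -> 0 <= L' ->
  `|ramp L (r + L) - ramp L' (r + L')| <= `|L - L'|.
Proof.
move=> L0 L'0; rewrite /ramp; case: (leP (r + L) 0) => rL;
  case: (leP (r + L') 0) => rL'; rewrite /Num.min;
  by case: ltP => ?; case: ltP => ?; have := ler_norm (L - L');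
  have := ler_norm (L' - L); rewrite (distrC L' L) ler_norml; lra.
Qed.

End ramp.

Section increments.
Context {R : realType}.
Implicit Types a b q p : R.

(** In use, [a] and [b] are the components of v = x - y along the normals at [x] and [y], [q] is the
    increment of the maximum, and [p], [p'] are the ramp values there. If q >= 0 then a >= 0 and p a
    >= p' a >= p' b; the other sign is symmetric. *)
Lemma monotone_increment_ge0 a b q p p' : b <= q <= a -> 0 <= p -> 0 <= p' ->
  (0 <= q -> p' <= p) -> (q <= 0 -> p <= p') -> 0 <= p * a - p' * b.
Proof.
move=> /andP[bq qa] p0 p'0 pos neg; have [q0|q0] := leP 0 q.
- have := pos q0; nra.
- have := neg (ltW q0); nra.
Qed.

(** The right-hand side is p (a - b) + q b, at least 2 e (a - b) + q b. For b >= 0, use 2 e >= a + b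
    and q b >= b^2. For b < 0, use q b >= a b. The ramp must therefore have height at least 2 [e] on
    the shell. *)
Lemma linear_increment_ge a b q p e : b <= q <= a -> `|a| <= e -> `|b| <= e ->
  2 * e <= p -> a ^+ 2 <= p * a - (p - q) * b.
Proof.
move=> /andP[bq qa]; rewrite !ler_norml => /andP[a1 a2] /andP[b1 b2] pe.
have H : 2 * e * (a - b) + q * b <= p * a - (p - q) * b.
  have : 0 <= (p - 2 * e) * (a - b) by apply: mulr_ge0; lra.
  lra.
apply: le_trans H.
have [a0|a0] := leP a 0.
  have : 0 <= (b - a) * (q - a) + (- a) * (a - b) + (-a) * (a - q).
    have h1 : 0 <= (b - a) * (q - a) by nra.
    have h2 : 0 <= - a * (a - b) by nra.
    have h3 : 0 <= - a * (a - q) by nra.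
    lra.
  have : 0 <= e * (a - b) by nra.
  nra.
have ea : 0 <= (e - a) * (a - b) by nra.
have [b0|b0] := leP 0 b.
  have : 0 <= (q - b) * b by nra.
  nra.
have : 0 <= (a - q) * (- b) by nra.
nra.
Qed.

End increments.

Section shell_field.
Context {R : realType} {d : nat}.
Variables (u : nat -> 'rV[R]_d) (s : nat -> R).
Hypothesis u1 : forall j, enorm (u j) = 1.
Implicit Types (x y v : 'rV[R]_d) (k : nat) (e h t : R).

(** The part of the ramp above level 0. The extra [e] preserves slope 1 at [x - v] when [x] is in
    the shell and |v| <= e. *)
Definition up_ramp e k t x : R := ramp (t + e) (affine_max u s k x).

(** The part below level 0. One [e] again preserves slope 1 after a step of length [e]; the other
    lifts the total height on the shell to at least 2 [e], as [linear_increment_ge] requires. *)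
Definition down_ramp e h k t x : R :=
  ramp (t + h + 2 * e) (affine_max u s k x + (t + h + 2 * e)).

Definition shell_field e h k t1 t2 x : 'rV[R]_d :=
  (up_ramp e k t1 x + down_ramp e h k t2 x) *: affine_grad u s k x.

Lemma up_ramp_ge0 e k t x : 0 <= e -> 0 <= t -> 0 <= up_ramp e k t x.
Proof. by move=> e0 t0; apply: ramp_ge0; exact: addr_ge0. Qed.

Lemma down_ramp_ge0 e h k t x : 0 <= e -> 0 <= h -> 0 <= t ->
  0 <= down_ramp e h k t x.
Proof. by move=> e0 h0 t0; apply: ramp_ge0; rewrite !addr_ge0// mulr_ge0. Qed.

Let inc k x y : let n := affine_grad u s k in
  dotv (n y) (x - y) <= affine_max u s k x - affine_max u s k y
    <= dotv (n x) (x - y).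
Proof.
rewrite /= affine_grad_ge /=.
by have := affine_grad_ge u s k y x; rewrite -opprB dotvNr; lra.
Qed.

Lemma shell_field_monotone e h k t1 t2 x y : 0 <= e -> 0 <= h ->
    0 <= t1 -> 0 <= t2 ->
  0 <= dotv (x - y) (shell_field e h k t1 t2 x - shell_field e h k t1 t2 y).
Proof.
move=> e0 h0 t10 t20; rewrite /shell_field dotvBr !dotvZr !(dotvC (x - y)).
apply: (monotone_increment_ge0 (inc k x y)).
- by rewrite addr_ge0 ?up_ramp_ge0 ?down_ramp_ge0.
- by rewrite addr_ge0 ?up_ramp_ge0 ?down_ramp_ge0.
- by move=> ?; apply: lerD; apply: ramp_homo; lra.
- by move=> ?; apply: lerD; apply: ramp_homo; lra.
Qed.

(** By [inc] the maximum changes by at most [e] between [x] and [y], so both points lie where the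
    two ramps add up to a single affine function of slope 1 of the maximum. *)
Lemma shell_field_increment e h k t1 t2 x y : 0 <= e -> 0 <= h ->
    0 <= t1 -> 0 <= t2 ->
    - (t2 + h) <= affine_max u s k x <= t1 -> enorm (x - y) <= e ->
  dotv (affine_grad u s k x) (x - y) ^+ 2 <=
  dotv (x - y) (shell_field e h k t1 t2 x - shell_field e h k t1 t2 y).
Proof.
move=> e0 h0 t10 t20 /andP[xl xu] xy.
rewrite [X in _ <= X]dotvBr !dotvZr !(dotvC (x - y)).
have /andP[i1 i2] := inc k x y.
have nle z : `|dotv (affine_grad u s k z) (x - y)| <= e.
  by apply: le_trans xy; have := dotv_norm_le (affine_grad u s k z) (x - y);
    rewrite enorm_affine_grad// mul1r.
have linE z : - (t2 + h + e) <= affine_max u s k z <= t1 + e ->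
    up_ramp e k t1 z + down_ramp e h k t2 z = affine_max u s k z + (t2 + h + 2 * e).
  rewrite /up_ramp /down_ramp /ramp.
  move: (affine_max u s k z) => r /andP[z1 z2].
  have r0 : 0 <= r + (t2 + h + 2 * e) by lra.
  rewrite (max_l r0).
  by case: (leP r 0) => ?; [rewrite !min_l|rewrite min_l ?min_r]; lra.
have := nle x; have := nle y; rewrite !ler_norml => /andP[? ?] /andP[? ?].
rewrite !linE; [|lra..].
set q := affine_max u s k x - affine_max u s k y.
have -> : affine_max u s k y + (t2 + h + 2 * e) =
    affine_max u s k x + (t2 + h + 2 * e) - q by rewrite /q; ring.
apply: linear_increment_ge (nle x) (nle y) _; first by rewrite i1.
lra.
Qed.

End shell_field.

(** * Expectations and independence *)

Section real_expectation.
Context {disp : measure_display} {T : measurableType disp} {R : realType}.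
Variable P : probability T R.
Implicit Types X Y f g : T -> R.

Definition L1_rv X := P.-integrable [set: T] (EFin \o X).

Lemma L1_measurable X : L1_rv X -> measurable_fun [set: T] X.
Proof. by move=> /measurable_int/measurable_EFinP. Qed.

Lemma eq_L1 X Y : X =1 Y -> L1_rv X -> L1_rv Y.
Proof. by move=> /funext ->. Qed.

Lemma L1_le X Y : measurable_fun [set: T] X ->
  (forall w, `|X w| <= Y w) -> L1_rv Y -> L1_rv X.
Proof.
move=> mX XY; apply: le_integrable => //; first exact/measurable_EFinP.
by move=> w _ /=; rewrite lee_fin (le_trans (XY w))// ler_norm.
Qed.

Lemma L1_bounded X M : measurable_fun [set: T] X ->
  (forall w, `|X w| <= M) -> L1_rv X.
Proof.
move=> mX XM; apply: (@L1_le _ (cst M)) => //.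
exact: finite_measure_integrable_cst.
Qed.

Lemma L1_cst c : L1_rv (fun=> c).
Proof. exact: finite_measure_integrable_cst. Qed.

Lemma L1D X Y : L1_rv X -> L1_rv Y ->
  L1_rv (fun w => X w + Y w).
Proof. by move=> iX iY; exact: (integrableD measurableT iX iY). Qed.

Lemma L1B X Y : L1_rv X -> L1_rv Y ->
  L1_rv (fun w => X w - Y w).
Proof. by move=> iX iY; exact: (integrableB measurableT iX iY). Qed.

Lemma L1Zl c X : L1_rv X -> L1_rv (fun w => c * X w).
Proof. by move=> iX; exact: (integrableZl measurableT c iX). Qed.

Lemma L1_sum (I : Type) (r : seq I) (p : pred I) (F : I -> T -> R) :
  (forall i, p i -> L1_rv (F i)) ->
  L1_rv (fun w => \sum_(i <- r | p i) F i w).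
Proof.
move=> iF; elim: r => [|i r IH].
  by apply: (eq_L1 (X := fun=> 0)); [move=> w; rewrite big_nil|exact: L1_cst].
have [pi|npi] := boolP (p i).
- apply: (eq_L1 (X := fun w => F i w + \sum_(j <- r | p j) F j w)).
    by move=> w; rewrite big_cons pi.
  by apply: L1D => //; exact: iF.
- by apply: eq_L1 IH => w; rewrite big_cons (negbTE npi).
Qed.

Lemma Rintegral_sum (I : Type) (r : seq I) (p : pred I) (F : I -> T -> R) :
  (forall i, p i -> L1_rv (F i)) ->
  \int[P]_w (\sum_(i <- r | p i) F i w) = \sum_(i <- r | p i) \int[P]_w F i w.
Proof.
move=> iF; elim: r => [|i r IH].
  rewrite big_nil; under eq_Rintegral do rewrite big_nil.
  by rewrite Rintegral_cst// mul0r.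
rewrite big_cons; under eq_Rintegral do rewrite big_cons.
case: ifP => // pi; rewrite RintegralD ?IH//; first exact: iF.
exact: L1_sum.
Qed.

Lemma Rintegral_probability_cst c : \int[P]_w c = c.
Proof.
have := expectation_cst P c; rewrite unlock /Rintegral => h.
by transitivity (fine c%:E) => //; congr fine.
Qed.

Lemma expectation_Rintegral X : L1_rv X -> ('E_P[X] = (\int[P]_w X w)%:E)%E.
Proof. by move=> iX; rewrite unlock /Rintegral fineK//; exact: integrable_fin_num. Qed.

(** This passes from real integrals of clipped variables to expectations that may be +oo. Were the
    integral of [X] infinite, its real value would default to 0, still a lower bound. *)
Lemma EFin_Rintegral_le_expectation X Y : measurable_fun [set: T] X ->
    measurable_fun [set: T] Y -> (forall w, 0 <= X w <= Y w) ->
  ((\int[P]_w X w)%:E <= 'E_P[Y])%E.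
Proof.
move=> mX mY XY.
have X0 w : 0 <= X w by have /andP[] := XY w.
apply: (@le_trans _ _ 'E_P[X]%E); last first.
  apply: expectation_le => //; last by apply: aeW => w; have /andP[] := XY w.
  by move=> w; have /andP[_] := XY w; exact: le_trans.
rewrite unlock /Rintegral; have : (0 <= \int[P]_w (X w)%:E)%E.
  by apply: integral_ge0 => w _; rewrite lee_fin.
by case: (\int[P]_w (X w)%:E)%E => [r| |]//= _; rewrite leey.
Qed.

End real_expectation.

Section independence.
Context {disp : measure_display} {T : measurableType disp} {R : realType}.
Variable P : probability T R.

(** Independence identifies the joint law with the product of the marginals on rectangles, hence
    everywhere; Tonelli gives integrability of the product and Fubini the factorization. *)
Lemma independent2_Rintegral_mul (F G : T -> R) :
    L1_rv P F -> L1_rv P G -> independent2 P F G ->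
  L1_rv P (fun w => F w * G w) /\
  \int[P]_w (F w * G w) = (\int[P]_w F w) * (\int[P]_w G w).
Proof.
move=> iF iG FG.
have mF := L1_measurable iF; have mG := L1_measurable iG.
pose X : {RV P >-> R} := HB.pack F
  (@isMeasurableFun.Build _ _ _ _ F mF).
pose Y : {RV P >-> R} := HB.pack G
  (@isMeasurableFun.Build _ _ _ _ G mG).
have mXY : measurable_fun [set: T] (fun w => (F w, G w)) by exact: measurable_fun_pair.
pose Z : {RV P >-> (R * R)%type} := HB.pack
  (fun w => (F w, G w)) (@isMeasurableFun.Build _ _ _ _ _ mXY).
pose mX := distribution P X; pose mY := distribution P Y.
have muE : forall A, measurable A -> (mX \x mY)%E A = distribution P Z A.
  apply: product_measure_unique => A B mA mB.
  exact: FG.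
have muZ A : measurable A -> distribution P Z A = (mX \x mY)%E A.
  by move=> mA; rewrite muE.
pose f (p : R * R) : \bar R := (p.1 * p.2)%:E.
have mf : measurable_fun [set: R * R] f.
  by apply/measurable_EFinP; exact: measurable_funM.
have iX : mX.-integrable [set: R] EFin.
  exact: (@integrable_pushforward _ _ _ _ _ F mF P [set: R] EFin
    (@EFin_measurable _ _) iF measurableT).
have iY : mY.-integrable [set: R] EFin.
  exact: (@integrable_pushforward _ _ _ _ _ G mG P [set: R] EFin
    (@EFin_measurable _ _) iG measurableT).
have EX : (\int[mX]_x x%:E = (\int[P]_w F w)%:E)%E.
  rewrite integral_distribution//.
  by rewrite /Rintegral fineK//; exact: (integrable_fin_num measurableT).
have EY : (\int[mY]_x x%:E = (\int[P]_w G w)%:E)%E.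
  rewrite integral_distribution//.
  by rewrite /Rintegral fineK//; exact: (integrable_fin_num measurableT).
have mabs : measurable_fun [set: R] (fun y : R => `|y|%:E).
  by apply/measurable_EFinP; exact: normr_measurable.
have abs0 (y : R) : [set: R] y -> (0%:E <= `|y|%:E)%E by rewrite lee_fin.
pose K := (\int[mY]_y `|y|%:E)%E.
have K0 : (0 <= K)%E by exact: integral_ge0.
have Kfin : K \is a fin_num.
  by rewrite ge0_fin_numE//; move/integrableP : iY => [].
have if_ : (mX \x mY)%E.-integrable [set: R * R] f.
  apply/integrable12ltyP => //.
  have -> : (fun x => \int[mY]_y `|f (x, y)|)%E = (fun x => K * `|x|%:E)%E.
    apply/funext => x; rewrite muleC.
    rewrite -(ge0_integralZl mY measurableT mabs abs0)//.
    by apply: eq_integral => y _; rewrite /f /= normrM.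
  rewrite (ge0_integralZl mX measurableT mabs abs0)// lte_mul_pinfty//.
  by move/integrableP : iX => [].
have iFG : P.-integrable [set: T] (f \o Z).
  apply/integrableP; split; first by apply/measurable_EFinP; exact: measurable_funM.
  rewrite -[ltLHS](@ge0_integral_distribution _ _ _ _ _ P Z (abse \o f))//=; last first.
    exact: measurableT_comp.
  rewrite (eq_measure_integral (mX \x mY)%E); last by move=> A mA _; exact: muZ.
  by move/integrableP : if_ => [].
split=> //.
rewrite /Rintegral -[in LHS](@integral_distribution _ _ _ _ _ P Z f)//.
rewrite (eq_measure_integral (mX \x mY)%E); last by move=> A mA _; exact: muZ.
rewrite -(integral12_prod_meas1 if_).
have -> : (fun x => \int[mY]_y f (x, y))%E =
    (fun x => (\int[P]_w G w)%:E * x%:E)%E.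
  apply/funext => x; rewrite -EY muleC -integralZl//.
by rewrite integralZl// EX -EFinM/= mulrC.
Qed.

Lemma independent2_comp (d1 d2 d1' d2' : measure_display)
    (E1 : measurableType d1) (E2 : measurableType d2)
    (E1' : measurableType d1') (E2' : measurableType d2')
    (X : T -> E1) (Y : T -> E2) (f : E1 -> E1') (g : E2 -> E2') :
    measurable_fun [set: E1] f -> measurable_fun [set: E2] g ->
    independent2 P X Y ->
  independent2 P (fun w => f (X w)) (fun w => g (Y w)).
Proof.
move=> mf mg XY B1 B2 mB1 mB2.
have := XY (f @^-1` B1) (g @^-1` B2).
by apply; rewrite -[_ @^-1` _]setTI; [exact: mf|exact: mg].
Qed.

Lemma mutually_independent_pair (d' : measure_display) (E : measurableType d')
    (I : finType) (X : I -> T -> E) (i j : I) :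
  mutually_independent P X -> i != j -> independent2 P (X i) (X j).
Proof.
move=> iX ij A B mA mB.
have := iX [set i; j]%SET (fun k => if k == i then A else B).
rewrite big_setU1 ?inE//= big_set1 eqxx eq_sym (negbTE ij) => <-; last first.
  by move=> k _; case: ifP.
congr (P _); apply/seteqP; split=> w /=.
  by move=> [Aw Bw] k /=; rewrite !inE => /orP[/eqP ->|/eqP ->];
    rewrite ?eqxx// eq_sym (negbTE ij).
move=> h; split.
  by have := h i; rewrite /= !inE eqxx; exact.
by have := h j; rewrite /= !inE eqxx orbT eq_sym (negbTE ij); exact.
Qed.

(** The cross terms vanish by pairwise independence and centering. *)
Lemma mutually_independent_Rintegral_sum_sqr (d' : measure_display)
    (E : measurableType d') (I : finType) (X : I -> T -> E) (f : I -> E -> R) :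
    mutually_independent P X -> (forall i, measurable_fun [set: E] (f i)) ->
    (forall i, L1_rv P (fun w => f i (X i w))) ->
    (forall i, L1_rv P (fun w => f i (X i w) ^+ 2)) ->
    (forall i, \int[P]_w f i (X i w) = 0) ->
  L1_rv P (fun w => (\sum_i f i (X i w)) ^+ 2) /\
  \int[P]_w ((\sum_i f i (X i w)) ^+ 2) = \sum_i \int[P]_w (f i (X i w) ^+ 2).
Proof.
move=> iX mf sf sf2 f0.
have prod i j : L1_rv P (fun w => f i (X i w) * f j (X j w)) /\
    \int[P]_w (f i (X i w) * f j (X j w)) =
    if i == j then \int[P]_w (f i (X i w) ^+ 2) else 0.
  have [<-|ij] := eqVneq i j; first by split=> //; exact: sf2.
  have [|s ->] := @independent2_Rintegral_mul (fun w => f i (X i w))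
      (fun w => f j (X j w)) (sf i) (sf j).
    exact/independent2_comp/mutually_independent_pair.
  by split=> //; rewrite f0 mul0r.
have sqrE w : \sum_i \sum_j f i (X i w) * f j (X j w) = (\sum_i f i (X i w)) ^+ 2.
  by rewrite expr2 mulr_suml; apply: eq_bigr => i _; rewrite mulr_sumr.
split.
  apply: eq_L1 sqrE _; apply: L1_sum => i _.
  by apply: L1_sum => j _; case: (prod i j).
rewrite -(funext sqrE) Rintegral_sum; last first.
  by move=> i _; apply: L1_sum => j _; case: (prod i j).
apply: eq_bigr => i _; rewrite Rintegral_sum; last by move=> j _; case: (prod i j).
rewrite (bigD1 i)//= (prod i i).2 eqxx big1 ?addr0// => j ji.
by rewrite (prod i j).2 eq_sym (negbTE ji).
Qed.

End independence.

(** * Measurability of the selected normal and of the ramps *)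

Section coordinate_measurability.
Context {R : realType} {d : nat}.

Lemma measurable_coord (k : 'I_d) :
  measurable_fun [set: borel_rV R d] (fun x : borel_rV R d => x ord0 k : R).
Proof.
apply: (measurability _ (RGenOpens.measurableE R)).
move=> _ [_ [a [b ->]] <-]; rewrite setTI.
apply: sub_sigma_algebra; apply: open_comp; last exact: interval_open.
by move=> x _; exact: coord_continuous.
Qed.

Context {disp : measure_display} {E : measurableType disp}.
Implicit Types (X Y : E -> 'rV[R]_d) (v : 'rV[R]_d) (t : E -> R).

(** Stable under vector operations by the scalar rules. Borel measurability implies it, and this one
    implication is how the random vectors enter. *)
Definition coord_measurable X :=
  forall k, measurable_fun [set: E] (fun w => X w ord0 k).

Lemma coord_measurable_cst v : coord_measurable (fun=> v).
Proof. by move=> k; exact: measurable_cst. Qed.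

Lemma coord_measurableB X Y : coord_measurable X -> coord_measurable Y ->
  coord_measurable (fun w => X w - Y w).
Proof.
move=> mX mY k; rewrite (_ : (fun w => _) = (fun w => X w ord0 k - Y w ord0 k)).
  exact: measurable_funB.
by apply/funext => w; rewrite !mxE.
Qed.

Lemma coord_measurable_sum (I : finType) (X : I -> E -> 'rV[R]_d) :
  (forall i, coord_measurable (X i)) -> coord_measurable (fun w => \sum_i X i w).
Proof.
move=> mX k; rewrite (_ : (fun w => _) = (fun w => \sum_i X i w ord0 k)).
  by apply: measurable_sum => i; exact: mX.
by apply/funext => w; rewrite summxE.
Qed.

Lemma measurable_dotv X Y : coord_measurable X -> coord_measurable Y ->
  measurable_fun [set: E] (fun w => dotv (X w) (Y w)).
Proof. by move=> mX mY; apply: measurable_sum => k; exact: measurable_funM. Qed.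

Lemma measurable_enorm X : coord_measurable X ->
  measurable_fun [set: E] (fun w => enorm (X w)).
Proof.
move=> mX; apply: (@measurableT_comp _ _ _ _ _ _ (@Num.sqrt R)).
  by apply: continuous_measurable_fun; exact: sqrt_continuous.
by apply: measurable_sum => k; apply: measurable_funX; exact: mX.
Qed.

Variables (u : nat -> 'rV[R]_d) (s : nat -> R).

Lemma measurable_affine_form j X : coord_measurable X ->
  measurable_fun [set: E] (fun w => affine_form u s j (X w)).
Proof.
move=> mX; apply: measurable_funB; last exact: measurable_cst.
by apply: measurable_dotv => //; exact: coord_measurable_cst.
Qed.

Lemma measurable_affine_max_grad k X : coord_measurable X ->
  measurable_fun [set: E] (fun w => affine_max u s k (X w)) /\
  coord_measurable (fun w => affine_grad u s k (X w)).
Proof.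
move=> mX; elim: k => [|k [IHmax IHgrad]].
  by split; [exact: measurable_affine_form|exact: coord_measurable_cst].
have mlt : measurable_fun [set: E]
    (fun w => affine_max u s k (X w) < affine_form u s k.+1 (X w)).
  by apply: measurable_fun_ltr => //; exact: measurable_affine_form.
split.
- rewrite (_ : (fun w => _) = (fun w =>
      if affine_max u s k (X w) < affine_form u s k.+1 (X w)
      then affine_form u s k.+1 (X w) else affine_max u s k (X w))).
    by apply: measurable_fun_ifT => //; exact: measurable_affine_form.
  by apply/funext => w; rewrite /affine_max /=; case: ifP.
- move=> i; rewrite (_ : (fun w => _) = (fun w =>
      if affine_max u s k (X w) < affine_form u s k.+1 (X w)
      then u k.+1 ord0 i else affine_grad u s k (X w) ord0 i)).
    by apply: measurable_fun_ifT => //; exact: IHgrad.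
  by apply/funext => w; rewrite /affine_grad /affine_max /=; case: ifP.
Qed.

Lemma measurable_affine_max k X : coord_measurable X ->
  measurable_fun [set: E] (fun w => affine_max u s k (X w)).
Proof. by move=> mX; have [] := measurable_affine_max_grad k mX. Qed.

Lemma measurable_affine_grad k X : coord_measurable X ->
  coord_measurable (fun w => affine_grad u s k (X w)).
Proof. by move=> mX; have [] := measurable_affine_max_grad k mX. Qed.

Lemma measurable_ramp t r : measurable_fun [set: E] t ->
  measurable_fun [set: E] r -> measurable_fun [set: E] (fun w => ramp (t w) (r w)).
Proof.
by move=> mt mr; apply: measurable_minr => //; apply: measurable_maxr.
Qed.

Lemma measurable_up_ramp e k t X : measurable_fun [set: E] t ->
  coord_measurable X -> measurable_fun [set: E] (fun w => up_ramp u s e k (t w) (X w)).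
Proof.
move=> mt mX; apply: measurable_ramp; last exact: measurable_affine_max.
exact: measurable_funD.
Qed.

Lemma measurable_down_ramp e h k t X : measurable_fun [set: E] t ->
  coord_measurable X ->
  measurable_fun [set: E] (fun w => down_ramp u s e h k (t w) (X w)).
Proof.
move=> mt mX; have mL : measurable_fun [set: E] (fun w => t w + h + 2 * e).
  by apply: measurable_funD => //; exact: measurable_funD.
apply: measurable_ramp => //; apply: measurable_funD => //.
exact: measurable_affine_max.
Qed.

End coordinate_measurability.

Section random_vector.
Context {R : realType} {d : nat}.
Context {disp : measure_display} {T : measurableType disp}.

Lemma random_vector_coord (X : T -> 'rV[R]_d) : random_vector X -> coord_measurable X.
Proof. by move=> mX k; exact: (measurableT_comp (measurable_coord k) mX). Qed.

Lemma coord_measurable_id : coord_measurable (fun x : borel_rV R d => x : 'rV[R]_d).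
Proof. exact: measurable_coord. Qed.

Lemma coord_measurable_snd :
  coord_measurable (fun p : (R * borel_rV R d)%type => p.2 : 'rV[R]_d).
Proof. by move=> k; exact: (measurableT_comp (measurable_coord k)). Qed.

End random_vector.

(** * Truncated second moments *)

Lemma exchange_big3 (V : nmodType) (I J K : finType) (F : I -> J -> K -> V) :
  \sum_i \sum_j \sum_k F i j k = \sum_k \sum_i \sum_j F i j k.
Proof.
by rewrite [RHS]exchange_big; apply: eq_bigr => i _; exact: exchange_big.
Qed.

Section moments.
Context {disp : measure_display} {T : measurableType disp} {R : realType}.
Variable P : probability T R.
Context {d n : nat}.
Variable xi : 'I_n -> T -> 'rV[R]_d.
Hypothesis xi_random : forall i, random_vector (xi i).
Hypothesis xi_indep : mutually_independent P (xi : 'I_n -> T -> borel_rV R d).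
Hypothesis xi_centered : forall i k, \int[P]_w (xi i w ord0 k) = 0.
Hypothesis xi_cov : forall k l,
  \sum_i \int[P]_w (xi i w ord0 k * xi i w ord0 l) = (k == l)%:R.
Hypothesis xi_cube : forall i, L1_rv P (fun w => enorm (xi i w) ^+ 3).

Implicit Types (i : 'I_n) (k l : 'I_d) (e : R) (v : 'rV[R]_d).

Let mxi i : coord_measurable (xi i) := random_vector_coord (xi_random i).

Lemma L1_enorm_exp i j : (j <= 3)%N ->
  L1_rv P (fun w => enorm (xi i w) ^+ j).
Proof.
move=> j3; apply: (L1_le (Y := fun w => 1 + enorm (xi i w) ^+ 3)).
- by apply: measurable_funX; exact: measurable_enorm.
- move=> w; have e0 := enorm_ge0 (xi i w); rewrite ger0_norm ?exprn_ge0//.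
  have [e1|/ltW e1] := leP (enorm (xi i w)) 1.
    by apply: (@le_trans _ _ 1); rewrite ?exprn_ile1// lerDl exprn_ge0.
  by apply: (@le_trans _ _ (enorm (xi i w) ^+ 3)); rewrite ?ler_weXn2l// lerDr.
- by apply: L1D => //; exact: L1_cst.
Qed.

Lemma L1_enorm i : L1_rv P (fun w => enorm (xi i w)).
Proof. exact: (@L1_enorm_exp i 1). Qed.

Lemma L1_coord i k : L1_rv P (fun w => xi i w ord0 k).
Proof.
apply: L1_le (L1_enorm i); first exact: mxi.
by move=> w; exact: norm_coord_le.
Qed.

Lemma norm_coord_mul_le (x : 'rV[R]_d) k l :
  `|x ord0 k * x ord0 l| <= enorm x ^+ 2.
Proof. by rewrite normrM expr2 ler_pM ?norm_coord_le. Qed.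

Lemma L1_coord_mul i k l :
  L1_rv P (fun w => xi i w ord0 k * xi i w ord0 l).
Proof.
apply: L1_le (L1_enorm_exp i (isT : (2 <= 3)%N)).
  by apply: measurable_funM; exact: mxi.
by move=> w; exact: norm_coord_mul_le.
Qed.

Lemma sum_Rintegral_enorm_sqr :
  \sum_i \int[P]_w (enorm (xi i w) ^+ 2) = d%:R.
Proof.
have E i : \int[P]_w (enorm (xi i w) ^+ 2) =
    \sum_k \int[P]_w (xi i w ord0 k * xi i w ord0 k).
  rewrite -Rintegral_sum; last by move=> k _; exact: L1_coord_mul.
  by apply: eq_Rintegral => w _; rewrite enorm_sqr.
rewrite (eq_bigr _ (fun i _ => E i)) exchange_big /=.
under eq_bigr do rewrite xi_cov eqxx.
by rewrite sumr_const card_ord.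
Qed.

Lemma sum_Rintegral_cube_gt0 : (0 < d)%N ->
  0 < \sum_i \int[P]_w (enorm (xi i w) ^+ 3).
Proof.
move=> d0; set g := \sum_i _; set N := n%:R + 1 : R.
have N0 : 0 < N by rewrite ltr_wpDl.
(* For x >= 0, x^2 <= N x^3 + N^-2, according to whether x <= 1/N. Summed over the [xi i], this
   bounds d by N g + n / N^2, and N = n + 1 makes the last term less than 1. *)
have le1 : 1 <= N * g + n%:R / N ^+ 2.
  apply: (@le_trans _ _ d%:R); first by rewrite ler1n.
  rewrite -sum_Rintegral_enorm_sqr /g mulr_sumr.
  have -> : n%:R / N ^+ 2 = \sum_(i < n) (N ^+ 2)^-1.
    by rewrite sumr_const card_ord mulr_natl.
  rewrite -big_split /=; apply: ler_sum => i _.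
  rewrite -(RintegralZl _ measurableT (xi_cube i)).
  rewrite -(Rintegral_probability_cst P (N ^+ 2)^-1).
  have cL1 : L1_rv P (fun w => N * enorm (xi i w) ^+ 3) by exact: L1Zl.
  rewrite -(RintegralD measurableT cL1 (L1_cst P _)).
  apply: le_Rintegral => //; first exact: L1_enorm_exp.
    by apply: L1D => //; exact: L1_cst.
  move=> w _; set x := enorm _; have x0 : 0 <= x by exact: enorm_ge0.
  rewrite -exprVn; have [xN|xN] := leP x N^-1.
    apply: (@le_trans _ _ (N^-1 ^+ 2)).
      by rewrite ler_pXn2r ?nnegrE ?invr_ge0// ltW.
    by rewrite lerDr mulr_ge0 ?exprn_ge0// ltW.
  apply: (@le_trans _ _ (N * x ^+ 3)); last by rewrite lerDl sqr_ge0.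
  rewrite exprS mulrA ler_peMl ?sqr_ge0//.
  by rewrite -ler_pdivrMl// mulr1 ltW.
have : n%:R / N ^+ 2 < 1.
  rewrite ltr_pdivrMr ?exprn_gt0// mul1r /N.
  by have : 0 <= n%:R :> R by []; nra.
by move=> lt1; rewrite -(pmulr_rgt0 _ N0); lra.
Qed.

Lemma Rintegral_enorm_sum_sqr :
  L1_rv P (fun w => enorm (\sum_i xi i w) ^+ 2) /\
  \int[P]_w (enorm (\sum_i xi i w) ^+ 2) = d%:R.
Proof.
have B k : L1_rv P (fun w => (\sum_i xi i w ord0 k) ^+ 2) /\
    \int[P]_w ((\sum_i xi i w ord0 k) ^+ 2) = 1.
  have [||||s ->] := @mutually_independent_Rintegral_sum_sqr _ _ _ P _
      (borel_rV R d) _ _ (fun i (x : borel_rV R d) => x ord0 k) xi_indep.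
  - by move=> i; exact: measurable_coord.
  - by move=> i; exact: L1_coord.
  - by move=> i; exact: L1_coord_mul.
  - by move=> i; exact: xi_centered.
  by split=> //; rewrite (xi_cov k k) eqxx.
have E w : enorm (\sum_i xi i w) ^+ 2 = \sum_k (\sum_i xi i w ord0 k) ^+ 2.
  by rewrite enorm_sqr; apply: eq_bigr => k _; rewrite summxE expr2.
split.
  apply: eq_L1 (fun w => esym (E w)) _.
  by apply: L1_sum => k _; case: (B k).
rewrite (eq_Rintegral _ (fun w _ => E w)) Rintegral_sum; last first.
  by move=> k _; case: (B k).
under eq_bigr do rewrite (B _).2.
by rewrite sumr_const card_ord.
Qed.

Lemma Rintegral_enorm_sum_le :
  L1_rv P (fun w => enorm (\sum_i xi i w)) /\
  \int[P]_w enorm (\sum_i xi i w) <= Num.sqrt d%:R.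
Proof.
have [s2 E2] := Rintegral_enorm_sum_sqr.
have sW : L1_rv P (fun w => enorm (\sum_i xi i w)).
  apply: (L1_le (Y := fun w => 1 + enorm (\sum_i xi i w) ^+ 2)).
  - by apply: measurable_enorm; exact: coord_measurable_sum.
  - by move=> w; rewrite ger0_norm ?enorm_ge0//; set a := enorm _; nra.
  - by apply: L1D => //; exact: L1_cst.
split=> //; set c := Num.sqrt d%:R.
have c0 : 0 <= c by exact: sqrtr_ge0.
have cc : c ^+ 2 = d%:R by rewrite sqr_sqrtr.
apply/ler_addgt0Pr => e e0.
(* The integral of (c + e - |W|)^2 >= 0. The added [e] makes the divisor c + e positive even for d =
   0. *)
have : 2 * (c + e) * \int[P]_w enorm (\sum_i xi i w) <= (c + e) ^+ 2 + c ^+ 2.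
  rewrite cc -E2 -RintegralZl// -(Rintegral_probability_cst P ((c + e) ^+ 2)).
  rewrite -RintegralD//; last exact: L1_cst.
  apply: le_Rintegral => //; first exact: L1Zl.
    by apply: L1D => //; exact: L1_cst.
  move=> w _; have := sqr_ge0 (c + e - enorm (\sum_i xi i w)); lra.
set J := \int[P]_w _.
have ce : 0 < c + e by lra.
by move=> h; rewrite -(ler_pM2l ce); nra.
Qed.

(** An entry of the truncated matrix x^T x. The cutoff matches the range of increments covered by
    [shell_field_increment], and it bounds the entries, so that their squares are integrable. *)
Definition trunc_prod e k l (x : 'rV[R]_d) : R :=
  if enorm x <= e then x ord0 k * x ord0 l else 0.

Definition trunc_cov e k l : R := \sum_i \int[P]_w trunc_prod e k l (xi i w).

Definition trunc_fluct e (w : T) : R :=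
  \sum_k \sum_l (\sum_i trunc_prod e k l (xi i w) - trunc_cov e k l) ^+ 2.

Lemma trunc_fluct_ge0 e w : 0 <= trunc_fluct e w.
Proof.
by apply: sumr_ge0 => k _; apply: sumr_ge0 => l _; exact: sqr_ge0.
Qed.

Lemma measurable_trunc_prod e k l :
  measurable_fun [set: borel_rV R d] (fun x : borel_rV R d => trunc_prod e k l x).
Proof.
apply: measurable_fun_ifT => //.
- apply: measurable_fun_ler => //; exact: (measurable_enorm coord_measurable_id).
- by apply: measurable_funM; exact: measurable_coord.
Qed.

Lemma L1_trunc_prod e i k l :
  L1_rv P (fun w => trunc_prod e k l (xi i w)).
Proof.
apply: L1_le (L1_enorm_exp i (isT : (2 <= 3)%N)).
  exact: (measurableT_comp (measurable_trunc_prod e k l) (xi_random i)).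
move=> w; rewrite /trunc_prod; case: ifP => _; first exact: norm_coord_mul_le.
by rewrite normr0 exprn_ge0// enorm_ge0.
Qed.

Lemma norm_trunc_prod_le e k l (x : 'rV[R]_d) : 0 <= e ->
  `|trunc_prod e k l x| <= e ^+ 2.
Proof.
move=> e0; rewrite /trunc_prod; case: ifP => [xe|_]; last by rewrite normr0 sqr_ge0.
apply: le_trans (norm_coord_mul_le x k l) _.
by rewrite ler_pXn2r ?nnegrE ?enorm_ge0.
Qed.

Lemma sum_trunc_prod_sqr_le e (x : 'rV[R]_d) :
  \sum_k \sum_l trunc_prod e k l x ^+ 2 <= e ^+ 2 * enorm x ^+ 2.
Proof.
rewrite /trunc_prod; case: (boolP (enorm x <= e)) => xe; last first.
  rewrite big1; last by move=> k _; rewrite big1// => l _; rewrite expr0n.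
  by rewrite mulr_ge0 ?sqr_ge0.
have -> : \sum_k \sum_l (x ord0 k * x ord0 l) ^+ 2 = enorm x ^+ 2 * enorm x ^+ 2.
  rewrite !enorm_sqr mulr_suml; apply: eq_bigr => k _; rewrite mulr_sumr.
  by apply: eq_bigr => l _; rewrite -!expr2 exprMn.
rewrite ler_wpM2r ?sqr_ge0// ler_pXn2r ?nnegrE ?enorm_ge0//.
by rewrite (le_trans _ xe) ?enorm_ge0.
Qed.

Lemma Rintegral_sqr_centered_le (X : T -> R) : L1_rv P X ->
    L1_rv P (fun w => X w ^+ 2) ->
  \int[P]_w ((X w - \int[P]_z X z) ^+ 2) <= \int[P]_w (X w ^+ 2).
Proof.
move=> iX iX2; set m := \int[P]_z X z.
have -> : \int[P]_w ((X w - m) ^+ 2) =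
    \int[P]_w ((X w ^+ 2 - (2 * m) * X w) + m ^+ 2).
  by apply: eq_Rintegral => w _; ring.
rewrite RintegralD//; [|by apply: L1B => //; exact: L1Zl|exact: L1_cst].
rewrite RintegralB//; last exact: L1Zl.
rewrite RintegralZl// Rintegral_probability_cst -/m.
by have := sqr_ge0 m; lra.
Qed.

(** [trunc_fluct] is the squared Hilbert-Schmidt norm of the centered truncated empirical
    covariance. Entrywise variances add over [i], and the squared entries for one [xi i] sum to at
    most e^2 |xi i|^2, whose total mean is e^2 d. *)
Lemma Rintegral_trunc_fluct_le e : 0 <= e ->
  L1_rv P (trunc_fluct e) /\ \int[P]_w trunc_fluct e w <= e ^+ 2 * d%:R.
Proof.
move=> e0.
pose b i k l := \int[P]_w trunc_prod e k l (xi i w).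
have bnd i k l : `|b i k l| <= e ^+ 2.
  rewrite (le_trans (le_normr_Rintegral _ _))//; first exact: L1_trunc_prod.
  rewrite -(Rintegral_probability_cst P (e ^+ 2)); apply: le_Rintegral => //.
  - exact/integrable_norm/L1_trunc_prod.
  - exact: L1_cst.
  - by move=> w _; exact: norm_trunc_prod_le.
have mprod i k l : measurable_fun [set: T] (fun w => trunc_prod e k l (xi i w)).
  exact/L1_measurable/L1_trunc_prod.
have sqr_L1 i k l : L1_rv P (fun w => trunc_prod e k l (xi i w) ^+ 2).
  apply: (@L1_bounded _ _ _ P _ ((e ^+ 2) ^+ 2)); first exact: measurable_funX.
  move=> w; rewrite normrX ler_pXn2r ?nnegrE ?sqr_ge0//.
  exact: norm_trunc_prod_le.
have B k l : L1_rv P (fun w =>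
      (\sum_i trunc_prod e k l (xi i w) - trunc_cov e k l) ^+ 2) /\
    \int[P]_w ((\sum_i trunc_prod e k l (xi i w) - trunc_cov e k l) ^+ 2) <=
    \sum_i \int[P]_w (trunc_prod e k l (xi i w) ^+ 2).
  have E w : (\sum_i (trunc_prod e k l (xi i w) - b i k l)) ^+ 2 =
      (\sum_i trunc_prod e k l (xi i w) - trunc_cov e k l) ^+ 2.
    by rewrite sumrB.
  have cL1 i : L1_rv P (fun w => trunc_prod e k l (xi i w) - b i k l).
    by apply: L1B; [exact: L1_trunc_prod|exact: L1_cst].
  have [||||s E2] := @mutually_independent_Rintegral_sum_sqr _ _ _ P _
      (borel_rV R d) _ _ (fun i (x : borel_rV R d) => trunc_prod e k l x - b i k l)
      xi_indep.
  - move=> i; apply: measurable_funB; last exact: measurable_cst.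
    exact: measurable_trunc_prod.
  - by move=> i; exact: cL1.
  - move=> i; apply: (@L1_bounded _ _ _ P _ ((e ^+ 2 + e ^+ 2) ^+ 2)).
      by apply: measurable_funX; exact: L1_measurable (cL1 i).
    move=> w; rewrite normrX ler_pXn2r ?nnegrE ?addr_ge0 ?sqr_ge0//.
    by rewrite (le_trans (ler_normB _ _))// lerD// norm_trunc_prod_le.
  - move=> i; rewrite RintegralB//; [|exact: L1_trunc_prod|exact: L1_cst].
    by rewrite Rintegral_probability_cst subrr.
  split; first exact: eq_L1 E s.
  rewrite -(eq_Rintegral _ (fun w _ => E w)) E2; apply: ler_sum => i _.
  by apply: Rintegral_sqr_centered_le => //; exact: L1_trunc_prod.
split; first by apply: L1_sum => k _; apply: L1_sum => l _; case: (B k l).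
rewrite Rintegral_sum; last by move=> k _; apply: L1_sum => l _; case: (B k l).
apply: (@le_trans _ _ (\sum_k \sum_l \sum_i
    \int[P]_w (trunc_prod e k l (xi i w) ^+ 2))).
  apply: ler_sum => k _; rewrite Rintegral_sum; last by move=> l _; case: (B k l).
  by apply: ler_sum => l _; case: (B k l).
rewrite exchange_big3 -sum_Rintegral_enorm_sqr mulr_sumr.
apply: ler_sum => i _; have i2 := L1_enorm_exp i (isT : (2 <= 3)%N).
rewrite -RintegralZl//.
have -> : \sum_k \sum_l \int[P]_w (trunc_prod e k l (xi i w) ^+ 2) =
    \int[P]_w (\sum_k \sum_l trunc_prod e k l (xi i w) ^+ 2).
  rewrite Rintegral_sum; last by move=> k _; exact: L1_sum.
  by apply: eq_bigr => k _; rewrite Rintegral_sum.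
apply: le_Rintegral => //; last by move=> w _; exact: sum_trunc_prod_sqr_le.
- by apply: L1_sum => k _; exact: L1_sum.
- exact: L1Zl.
Qed.

Definition trunc_quad e v (x : 'rV[R]_d) : R :=
  if enorm x <= e then dotv v x ^+ 2 else 0.

Lemma trunc_quadE e v (x : 'rV[R]_d) :
  \sum_k \sum_l v ord0 k * v ord0 l * trunc_prod e k l x = trunc_quad e v x.
Proof.
rewrite /trunc_quad /trunc_prod; case: (enorm x <= e); last first.
  by rewrite big1// => k _; rewrite big1// => l _; rewrite mulr0.
rewrite expr2 mulr_suml; apply: eq_bigr => k _; rewrite mulr_sumr.
by apply: eq_bigr => l _; ring.
Qed.

(** Where the truncation acts, |x| > e, so (v.x)^2 <= |x|^2 <= |x|^3 / e. *)
Lemma trunc_quad_ge e v (x : 'rV[R]_d) : 0 < e -> enorm v = 1 ->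
  dotv v x ^+ 2 - enorm x ^+ 3 / e <= trunc_quad e v x.
Proof.
move=> e0 v1; rewrite /trunc_quad; have x0 := enorm_ge0 x.
case: (leP (enorm x) e) => xe; first by rewrite lerBlDr lerDl divr_ge0 ?exprn_ge0// ltW.
rewrite subr_le0 ler_pdivlMr//.
have : dotv v x ^+ 2 <= enorm x ^+ 2.
  rewrite -real_normK ?num_real// ler_pXn2r ?nnegrE//.
  by have := dotv_norm_le v x; rewrite v1 mul1r.
by have := sqr_ge0 (dotv v x); rewrite exprS; nra.
Qed.

Lemma trunc_cov_ge e v : 0 < e -> enorm v = 1 ->
  1 - (\sum_i \int[P]_w (enorm (xi i w) ^+ 3)) / e <=
  \sum_k \sum_l v ord0 k * v ord0 l * trunc_cov e k l.
Proof.
move=> e0 v1.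
have E1 : \sum_i \int[P]_w (dotv v (xi i w) ^+ 2) = 1.
  have -> : 1 = \sum_k \sum_l v ord0 k * v ord0 l * (k == l)%:R :> R.
    transitivity (enorm v ^+ 2); first by rewrite v1 expr1n.
    rewrite enorm_sqr; apply: eq_bigr => k _.
    rewrite (bigD1 k)//= eqxx mulr1 big1 ?addr0// => l lk.
    by rewrite eq_sym (negbTE lk) mulr0.
  under [RHS]eq_bigr do under eq_bigr do rewrite -xi_cov mulr_sumr.
  rewrite [RHS]exchange_big3; apply: eq_bigr => i _.
  have E w : dotv v (xi i w) ^+ 2 = \sum_k \sum_l
      v ord0 k * v ord0 l * (xi i w ord0 k * xi i w ord0 l).
    rewrite expr2 mulr_suml; apply: eq_bigr => k _; rewrite mulr_sumr.
    by apply: eq_bigr => l _; ring.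
  have sL1 k l : L1_rv P (fun w =>
      v ord0 k * v ord0 l * (xi i w ord0 k * xi i w ord0 l)).
    exact/L1Zl/L1_coord_mul.
  rewrite (eq_Rintegral _ (fun w _ => E w)) Rintegral_sum; last first.
    by move=> k _; exact: L1_sum.
  apply: eq_bigr => k _; rewrite Rintegral_sum//; apply: eq_bigr => l _.
  by rewrite RintegralZl//; exact: L1_coord_mul.
have qL1 i : L1_rv P (fun w => trunc_quad e v (xi i w)).
  apply: (eq_L1 (fun w => trunc_quadE e v (xi i w))).
  by apply: L1_sum => k _; apply: L1_sum => l _; exact/L1Zl/L1_trunc_prod.
have E2 : \sum_k \sum_l v ord0 k * v ord0 l * trunc_cov e k l =
    \sum_i \int[P]_w trunc_quad e v (xi i w).
  under eq_bigr do under eq_bigr do rewrite mulr_sumr.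
  rewrite exchange_big3; apply: eq_bigr => i _.
  rewrite -(eq_Rintegral _ (fun w _ => trunc_quadE e v (xi i w))).
  rewrite Rintegral_sum; last first.
    by move=> k _; apply: L1_sum => l _; exact/L1Zl/L1_trunc_prod.
  apply: eq_bigr => k _; rewrite Rintegral_sum; last first.
    by move=> l _; exact/L1Zl/L1_trunc_prod.
  by apply: eq_bigr => l _; rewrite RintegralZl//; exact: L1_trunc_prod.
rewrite E2 -E1 mulr_suml -sumrB; apply: ler_sum => i _.
have dL1 : L1_rv P (fun w => dotv v (xi i w) ^+ 2).
  apply: L1_le (L1_enorm_exp i (isT : (2 <= 3)%N)).
    apply: measurable_funX; apply: measurable_dotv; last exact: mxi.
    exact: coord_measurable_cst.
  move=> w; rewrite normrX ler_pXn2r ?nnegrE ?enorm_ge0//.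
  by have := dotv_norm_le v (xi i w); rewrite v1 mul1r.
have cL1 : L1_rv P (fun w => e^-1 * enorm (xi i w) ^+ 3) by exact: L1Zl.
have -> : (\int[P]_w (enorm (xi i w) ^+ 3)) / e =
    \int[P]_w (e^-1 * enorm (xi i w) ^+ 3).
  by rewrite (RintegralZl _ measurableT (xi_cube i)) mulrC.
rewrite -RintegralB//.
apply: le_Rintegral => //; [exact: L1B|exact: qL1|].
by move=> w _; rewrite mulrC trunc_quad_ge.
Qed.

(* AM-GM, [2 |a b| <= c a ^ 2 + b ^ 2 / c], entry by entry. *)
Lemma sum_trunc_quad_ge e v c w : 0 < c -> enorm v = 1 ->
  \sum_k \sum_l v ord0 k * v ord0 l * trunc_cov e k l -
    (c + trunc_fluct e w / c) / 2 <=
  \sum_i trunc_quad e v (xi i w).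
Proof.
move=> c0 v1.
have <- : \sum_k \sum_l v ord0 k * v ord0 l * (\sum_i trunc_prod e k l (xi i w)) =
    \sum_i trunc_quad e v (xi i w).
  under eq_bigr do under eq_bigr do rewrite mulr_sumr.
  rewrite exchange_big3; apply: eq_bigr => i _; exact: trunc_quadE.
rewrite lerBlDr -lerBlDl.
have -> : (c + trunc_fluct e w / c) / 2 = \sum_k \sum_l
    (c * (v ord0 k ^+ 2 * v ord0 l ^+ 2) +
     (\sum_i trunc_prod e k l (xi i w) - trunc_cov e k l) ^+ 2 / c) / 2.
  under eq_bigr do rewrite -mulr_suml big_split /= -mulr_suml -!mulr_sumr.
  rewrite -mulr_suml big_split /= -mulr_suml -mulr_sumr -mulr_suml.
  have -> : \sum_k v ord0 k ^+ 2 = 1.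
    transitivity (enorm v ^+ 2); last by rewrite v1 expr1n.
    by rewrite enorm_sqr; apply: eq_bigr => k _; rewrite expr2.
  by rewrite !mulr1.
rewrite -sumrB; apply: ler_sum => k _; rewrite -sumrB; apply: ler_sum => l _.
rewrite -mulrBr; set a := v ord0 k; set b := v ord0 l.
set N := trunc_cov e k l; set M := \sum_i _.
have -> : (M - N) ^+ 2 / c = c * ((M - N) / c) ^+ 2 by field; rewrite gt_eqF.
have -> : N - M = - c * ((M - N) / c) by field; rewrite gt_eqF.
move: ((M - N) / c) => t.
have := mulr_ge0 (ltW c0) (sqr_ge0 (a * b + t)); nra.
Qed.

End moments.

(** * Concentration *)

Section shell_field_bounds.
Context {R : realType} {d : nat}.
Variables (u : nat -> 'rV[R]_d) (s : nat -> R).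
Hypothesis u1 : forall j, enorm (u j) = 1.
Implicit Types (x : 'rV[R]_d) (e h t : R) (k : nat).

Lemma up_ramp_lip e k t t' x :
  `|up_ramp u s e k t x - up_ramp u s e k t' x| <= `|t - t'|.
Proof.
by apply: le_trans (ramp_lip _ _ _) _; rewrite opprD addrACA subrr addr0.
Qed.

Lemma down_ramp_lip e h k t t' x : 0 <= e -> 0 <= h -> 0 <= t -> 0 <= t' ->
  `|down_ramp u s e h k t x - down_ramp u s e h k t' x| <= `|t - t'|.
Proof.
move=> e0 h0 t0 t'0; apply: le_trans (ramp_shift_lip _ _ _) _; [lra|lra|].
by rewrite !opprD !addrA (_ : _ - _ = t - t')//; ring.
Qed.

Lemma norm_up_ramp_grad_le e k t x : 0 <= e -> 0 <= t ->
  enorm (up_ramp u s e k t x *: affine_grad u s k x) <= t + e.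
Proof.
move=> e0 t0; rewrite enormZ enorm_affine_grad// mulr1.
by rewrite ger0_norm ?up_ramp_ge0//; exact: ramp_le.
Qed.

Lemma norm_down_ramp_grad_le e h k t x : 0 <= e -> 0 <= h -> 0 <= t ->
  enorm (down_ramp u s e h k t x *: affine_grad u s k x) <= t + h + 2 * e.
Proof.
move=> e0 h0 t0; rewrite enormZ enorm_affine_grad// mulr1.
by rewrite ger0_norm ?down_ramp_ge0//; exact: ramp_le.
Qed.

(** The normal does not involve the Deltas: changing them changes only the scalar factor of a unit
    vector, and each ramp sees its own Delta. *)
Lemma shell_field_change e h k t1 t2 t1' t2' x y : 0 <= e -> 0 <= h ->
    0 <= t2 -> 0 <= t2' ->
  dotv (up_ramp u s e k t1' x *: affine_grad u s k x) y +
  dotv (down_ramp u s e h k t2' x *: affine_grad u s k x) y -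
  dotv y (shell_field u s e h k t1 t2 x) <=
  enorm y * `|t1 - t1'| + enorm y * `|t2 - t2'|.
Proof.
move=> e0 h0 t20 t2'0.
rewrite /shell_field dotvZr !dotvZl (dotvC y).
have ny : `|dotv (affine_grad u s k x) y| <= enorm y.
  by have := dotv_norm_le (affine_grad u s k x) y; rewrite enorm_affine_grad// mul1r.
have l1 := up_ramp_lip e k t1' t1 x.
have l2 := down_ramp_lip k x e0 h0 t2'0 t20.
set q := dotv _ y in ny *; set N := enorm y in ny *.
rewrite -!mulrDl -mulrBl; apply: le_trans (ler_norm _) _; rewrite normrM.
rewrite -mulrDr mulrC ler_pM// opprD addrACA (le_trans (ler_normD _ _))//.
by rewrite (distrC t1) (distrC t2) lerD.
Qed.

End shell_field_bounds.

(** Coordinate by coordinate, the mean of the product factors and the centered factor kills it. The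
    bound [M] provides integrability. *)
Lemma leave_one_out_mean0 (disp : measure_display) (T : measurableType disp)
    (R : realType) (P : probability T R) (d : nat) (D : T -> R)
    (V x : T -> 'rV[R]_d) (F : (R * borel_rV R d)%type -> 'rV[R]_d) (M : R) :
    leave_one_out_independent P D V x -> coord_measurable F ->
    coord_measurable (fun w => F (D w, V w)) ->
    (forall w, enorm (F (D w, V w)) <= M) ->
    (forall k, L1_rv P (fun w => x w ord0 k)) ->
    (forall k, \int[P]_w (x w ord0 k) = 0) ->
  L1_rv P (fun w => dotv (F (D w, V w)) (x w)) /\
  \int[P]_w dotv (F (D w, V w)) (x w) = 0.
Proof.
move=> DVx mF mFDV FM xL1 x0.
have FL1 k : L1_rv P (fun w => F (D w, V w) ord0 k).
  apply: (@L1_bounded _ _ _ P _ M); first exact: mFDV.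
  by move=> w; exact: le_trans (norm_coord_le _ _) (FM w).
have prod k : L1_rv P (fun w => F (D w, V w) ord0 k * x w ord0 k) /\
    \int[P]_w (F (D w, V w) ord0 k * x w ord0 k) = 0.
  have [|sL1 ->] := independent2_Rintegral_mul (FL1 k) (xL1 k).
    exact: (independent2_comp (mF k) (measurable_coord k) DVx).
  by split=> //; rewrite x0 mulr0.
split; first by apply: L1_sum => k _; case: (prod k).
rewrite /dotv Rintegral_sum; last by move=> k _; case: (prod k).
by rewrite big1// => k _; case: (prod k).
Qed.

Section shell_concentration.
Context {disp : measure_display} {T : measurableType disp} {R : realType}.
Variable P : probability T R.
Context {d n : nat}.
Variable xi : 'I_n -> T -> 'rV[R]_d.
Hypothesis xi_random : forall i, random_vector (xi i).
Hypothesis xi_indep : mutually_independent P (xi : 'I_n -> T -> borel_rV R d).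
Hypothesis xi_centered : forall i k, \int[P]_w (xi i w ord0 k) = 0.
Hypothesis xi_cov : forall k l,
  \sum_i \int[P]_w (xi i w ord0 k * xi i w ord0 l) = (k == l)%:R.
Hypothesis xi_cube : forall i, L1_rv P (fun w => enorm (xi i w) ^+ 3).

Variables (u : nat -> 'rV[R]_d) (s : nat -> R).
Hypothesis u1 : forall j, enorm (u j) = 1.

Let W w := \sum_i xi i w.

Definition shell k (D1 D2 : T -> R) (h : R) : set T :=
  [set w | - (D2 w + h) <= affine_max u s k (\sum_i xi i w) <= D1 w].

Let mxi i : coord_measurable (xi i) := random_vector_coord (xi_random i).

Let mW : coord_measurable W := coord_measurable_sum mxi.

Lemma measurable_shell k D1 D2 h : measurable_fun [set: T] D1 ->
  measurable_fun [set: T] D2 -> measurable (shell k D1 D2 h).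
Proof.
move=> mD1 mD2.
have m1 : measurable_fun [set: T] (fun w => - (D2 w + h) <= affine_max u s k (W w)).
  apply: measurable_fun_ler; last exact: measurable_affine_max.
  by apply: measurable_funN; exact: measurable_funD.
have m2 : measurable_fun [set: T] (fun w => affine_max u s k (W w) <= D1 w).
  by apply: measurable_fun_ler => //; exact: measurable_affine_max.
have := measurable_and m1 m2 measurableT (Y := [set true]) I.
by rewrite setTI.
Qed.

(** All inequalities hold at each fixed [w], with the Deltas frozen as parameters of the field. The
    sum on the left has mean 0 once the leave-one-out variables are inserted. *)
Lemma shell_pointwise k (D1 D2 : T -> R) (D1i D2i : 'I_n -> R) w e h c :
    0 < e -> 0 <= h -> 0 < c -> 0 <= D1 w -> 0 <= D2 w -> (forall i, 0 <= D2i i) ->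
    2 * \sum_i \int[P]_w (enorm (xi i w) ^+ 3) <= e ->
  \1_(shell k D1 D2 h) w / 2 +
    \sum_i (dotv (up_ramp u s e k (D1i i) (W w - xi i w)
                    *: affine_grad u s k (W w - xi i w)) (xi i w) +
            dotv (down_ramp u s e h k (D2i i) (W w - xi i w)
                    *: affine_grad u s k (W w - xi i w)) (xi i w))
  <= (c + trunc_fluct P xi e w / c) / 2 +
     (enorm (W w) * (D1 w + D2 w) + (h + 3 * e) * enorm (W w) +
     \sum_i (enorm (xi i w) * `|D1 w - D1i i| + enorm (xi i w) * `|D2 w - D2i i|)).
Proof.
move=> e0 h0 c0 D10 D20 D2i0 ge.
pose f x := shell_field u s e h k (D1 w) (D2 w) x.
pose a i := dotv (xi i w) (f (W w) - f (W w - xi i w)).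
have xiE i : xi i w = W w - (W w - xi i w) by rewrite subKr.
have a0 i : 0 <= a i.
  by rewrite /a [X in dotv X _]xiE shell_field_monotone// ltW.
have Z0 : 0 <= trunc_fluct P xi e w / c.
  by rewrite divr_ge0 ?trunc_fluct_ge0// ltW.
(* Off the shell, monotonicity of the field suffices. On it, the increments dominate the truncated
   quadratic form in the direction of the normal at [W w]; for |xi i| > e the form is 0 and
   monotonicity suffices again. *)
have step1 : \1_(shell k D1 D2 h) w / 2 <=
    (c + trunc_fluct P xi e w / c) / 2 + \sum_i a i.
  rewrite indicE; have [wS|_] := boolP (w \in shell k D1 D2 h); last first.
    by rewrite mul0r addr_ge0 ?sumr_ge0//; lra.
  move: wS; rewrite inE /shell /= => wS.
  have v1 := enorm_affine_grad s u1 k (W w).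
  have := trunc_cov_ge xi_random xi_cov xi_cube e0 v1.
  have := sum_trunc_quad_ge P xi e w c0 v1.
  have : \sum_i trunc_quad e (affine_grad u s k (W w)) (xi i w) <= \sum_i a i.
    apply: ler_sum => i _; rewrite /trunc_quad.
    case: (leP (enorm (xi i w)) e) => // xe.
    rewrite /a [X in dotv X (_ - _)]xiE [X in dotv _ X ^+ 2]xiE.
    by apply: shell_field_increment => //; rewrite ?subKr// ltW.
  have : (\sum_i \int[P]_w (enorm (xi i w) ^+ 3)) / e <= 1 / 2.
    by rewrite ler_pdivrMr//; lra.
  set B := \sum_k _; lra.
have step2 : \sum_i dotv (xi i w) (f (W w)) <=
    enorm (W w) * (D1 w + D2 w) + (h + 3 * e) * enorm (W w).
  rewrite (eq_bigr _ (fun i _ => dotvC _ _)) -dotv_sumr dotvC -/(W w).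
  apply: le_trans (dotv_le _ _) _.
  have -> : enorm (W w) * (D1 w + D2 w) + (h + 3 * e) * enorm (W w) =
    enorm (W w) * ((D1 w + e) + (D2 w + h + 2 * e)) by ring.
  rewrite ler_wpM2l ?enorm_ge0// /f /shell_field scalerDl.
  apply: le_trans (enormD _ _) _; apply: lerD.
    by apply: norm_up_ramp_grad_le => //; exact: ltW.
  by apply: norm_down_ramp_grad_le => //; exact: ltW.
have step3 : \sum_i a i = \sum_i dotv (xi i w) (f (W w)) -
    \sum_i dotv (xi i w) (f (W w - xi i w)).
  by rewrite -sumrB; apply: eq_bigr => i _; rewrite -dotvBr.
have step4 : \sum_i (dotv (up_ramp u s e k (D1i i) (W w - xi i w)
                    *: affine_grad u s k (W w - xi i w)) (xi i w) +
            dotv (down_ramp u s e h k (D2i i) (W w - xi i w)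
                    *: affine_grad u s k (W w - xi i w)) (xi i w)) -
    \sum_i dotv (xi i w) (f (W w - xi i w)) <=
    \sum_i (enorm (xi i w) * `|D1 w - D1i i| + enorm (xi i w) * `|D2 w - D2i i|).
  rewrite -sumrB; apply: ler_sum => i _.
  by apply: shell_field_change => //; exact: ltW.
move: step1 step2 step4; rewrite step3.
set S1 := \sum_i (dotv _ _ + _); set S2 := \sum_i (enorm _ * _ + _); lra.
Qed.

Lemma shell_concentration k (D1 D2 : T -> R) (D1i D2i : 'I_n -> T -> R) (g m : R) :
    (0 < d)%N -> 0 < g -> \sum_i \int[P]_w (enorm (xi i w) ^+ 3) <= g ->
    measurable_fun [set: T] D1 -> measurable_fun [set: T] D2 ->
    (forall i, measurable_fun [set: T] (D1i i)) ->
    (forall i, measurable_fun [set: T] (D2i i)) ->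
    (forall w, 0 <= D1 w <= m) -> (forall w, 0 <= D2 w <= m) ->
    (forall i w, 0 <= D1i i w <= m) -> (forall i w, 0 <= D2i i w <= m) ->
    (forall i, leave_one_out_independent P (D1i i) (fun w => W w - xi i w) (xi i)) ->
    (forall i, leave_one_out_independent P (D2i i) (fun w => W w - xi i w) (xi i)) ->
  fine (P (shell k D1 D2 g)) <= 18 * Num.sqrt d%:R * g +
    2 * \int[P]_w (enorm (W w) * (D1 w + D2 w)) +
    2 * \sum_i (\int[P]_w (enorm (xi i w) * `|D1 w - D1i i w|) +
                \int[P]_w (enorm (xi i w) * `|D2 w - D2i i w|)).
Proof.
move=> d0 g0 gE mD1 mD2 mD1i mD2i D1m D2m D1im D2im ind1 ind2.
(* [c] minimizes the mean bound (c + e^2 d / c) / 2 for the fluctuation term, with value e q = 2 g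
   sqrt d. The field contributes (g + 3 e) q = 7 g sqrt d, and doubling the sum of both gives 18. *)
pose e := 2 * g; pose q := Num.sqrt d%:R : R; pose c := e * q.
have e0 : 0 < e by rewrite /e; lra.
have q0 : 0 < q by rewrite sqrtr_gt0 ltr0n.
have c0 : 0 < c by exact: mulr_gt0.
have le0 (X : T -> R) : (forall w, 0 <= X w <= m) -> forall w, 0 <= X w.
  by move=> h w; case/andP: (h w).
have lem (X : T -> R) : (forall w, 0 <= X w <= m) -> forall w, X w <= m.
  by move=> h w; case/andP: (h w).
have mS := measurable_shell k g mD1 mD2.
have mV i : coord_measurable (fun w => W w - xi i w) by exact: coord_measurableB.
have xiL1 i l : L1_rv P (fun w => xi i w ord0 l) by exact: L1_coord.
pose Fup (p : (R * borel_rV R d)%type) : 'rV[R]_d :=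
  up_ramp u s e k p.1 p.2 *: affine_grad u s k p.2.
pose Fdown (p : (R * borel_rV R d)%type) : 'rV[R]_d :=
  down_ramp u s e g k p.1 p.2 *: affine_grad u s k p.2.
pose H1 i w := dotv (Fup (D1i i w, W w - xi i w)) (xi i w).
pose H2 i w := dotv (Fdown (D2i i w, W w - xi i w)) (xi i w).
have H1P i : L1_rv P (H1 i) /\ \int[P]_w H1 i w = 0.
  apply: (leave_one_out_mean0 (M := m + e) (ind1 i)) => //.
  - move=> l; rewrite (_ : (fun w => _) = (fun p : (R * borel_rV R d)%type =>
        up_ramp u s e k p.1 p.2 * affine_grad u s k p.2 ord0 l)); last first.
      by apply/funext => p; rewrite mxE.
    apply: measurable_funM; last first.
      exact: (measurable_affine_grad u s k coord_measurable_snd).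
    exact: (measurable_up_ramp _ _ _ _ measurable_fst coord_measurable_snd).
  - move=> l; rewrite (_ : (fun w => _) = (fun w =>
        up_ramp u s e k (D1i i w) (W w - xi i w) *
        affine_grad u s k (W w - xi i w) ord0 l)); last first.
      by apply/funext => p; rewrite mxE.
    apply: measurable_funM; first exact: measurable_up_ramp.
    exact: measurable_affine_grad.
  - move=> w; have t0 := le0 _ (D1im i) w.
    apply: (le_trans (norm_up_ramp_grad_le s u1 k (W w - xi i w) (ltW e0) t0)).
    by rewrite lerD2r lem.
have H2P i : L1_rv P (H2 i) /\ \int[P]_w H2 i w = 0.
  apply: (leave_one_out_mean0 (M := m + g + 2 * e) (ind2 i)) => //.
  - move=> l; rewrite (_ : (fun w => _) = (fun p : (R * borel_rV R d)%type =>
        down_ramp u s e g k p.1 p.2 * affine_grad u s k p.2 ord0 l)); last first.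
      by apply/funext => p; rewrite mxE.
    apply: measurable_funM; last first.
      exact: (measurable_affine_grad u s k coord_measurable_snd).
    exact: (measurable_down_ramp _ _ _ _ _ measurable_fst coord_measurable_snd).
  - move=> l; rewrite (_ : (fun w => _) = (fun w =>
        down_ramp u s e g k (D2i i w) (W w - xi i w) *
        affine_grad u s k (W w - xi i w) ord0 l)); last first.
      by apply/funext => p; rewrite mxE.
    apply: measurable_funM; first exact: measurable_down_ramp.
    exact: measurable_affine_grad.
  - move=> w; have t0 := le0 _ (D2im i) w.
    apply: (le_trans
      (norm_down_ramp_grad_le s u1 k (W w - xi i w) (ltW e0) (ltW g0) t0)).
    by rewrite !lerD2r lem.
have [ZL1 Zle] := Rintegral_trunc_fluct_le xi_random xi_indep xi_cov xi_cube (ltW e0).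
have [WL1 Wle] := Rintegral_enorm_sum_le xi_random xi_indep xi_centered xi_cov xi_cube.
have xL1 i : L1_rv P (fun w => enorm (xi i w)) by exact: L1_enorm.
have WDL1 : L1_rv P (fun w => enorm (W w) * (D1 w + D2 w)).
  apply: (L1_le (Y := fun w => (m + m) * enorm (W w))); last exact: L1Zl.
    apply: measurable_funM; first exact: measurable_enorm.
    exact: measurable_funD.
  move=> w; have d1 := D1m w; have d2 := D2m w; have en := enorm_ge0 (W w).
  by rewrite ger0_norm ?mulr_ge0//; [rewrite mulrC ler_wpM2r//|]; lra.
have xDL1 i (X Y : T -> R) : measurable_fun [set: T] X -> measurable_fun [set: T] Y ->
    (forall w, 0 <= X w <= m) -> (forall w, 0 <= Y w <= m) ->
    L1_rv P (fun w => enorm (xi i w) * `|X w - Y w|).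
  move=> mX mY X0 Y0; 
  apply: (L1_le (Y := fun w => m * enorm (xi i w))); last exact: L1Zl.
    apply: measurable_funM; first exact: measurable_enorm.
    by apply: measurableT_comp => //; exact: measurable_funB.
  move=> w; have x0 := X0 w; have y0 := Y0 w.
  rewrite normrM normr_id ger0_norm ?enorm_ge0// mulrC ler_wpM2r ?enorm_ge0//.
  by rewrite ler_norml; lra.
have SL1 : L1_rv P (fun w => \1_(shell k D1 D2 g) w / 2).
  apply: (@L1_bounded _ _ _ P _ 1).
    by apply: measurable_funM => //; exact: measurable_indic.
  by move=> w; rewrite indicE; case: (_ \in _) => /=; rewrite ger0_norm; lra.
have HL1 i : L1_rv P (fun w => H1 i w + H2 i w).
  by apply: L1D; [case: (H1P i)|case: (H2P i)].
have DL1 i : L1_rv P (fun w =>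
    enorm (xi i w) * `|D1 w - D1i i w| + enorm (xi i w) * `|D2 w - D2i i w|).
  by apply: L1D; exact: xDL1.
have lhsL1 : L1_rv P (fun w => \1_(shell k D1 D2 g) w / 2 + \sum_i (H1 i w + H2 i w)).
  by apply: L1D => //; exact: L1_sum.
have Z2L1 : L1_rv P (fun w => 2^-1 * c + (2 * c)^-1 * trunc_fluct P xi e w).
  by apply: L1D; [exact: L1_cst|exact: L1Zl].
have W2L1 : L1_rv P (fun w => enorm (W w) * (D1 w + D2 w) + (g + 3 * e) * enorm (W w)).
  by apply: L1D => //; exact: L1Zl.
have sDL1 : L1_rv P (fun w => \sum_i (enorm (xi i w) * `|D1 w - D1i i w| +
    enorm (xi i w) * `|D2 w - D2i i w|)) by exact: L1_sum.
have WsL1 : L1_rv P (fun w => enorm (W w) * (D1 w + D2 w) + (g + 3 * e) * enorm (W w) +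
    \sum_i (enorm (xi i w) * `|D1 w - D1i i w| + enorm (xi i w) * `|D2 w - D2i i w|)).
  exact: L1D.
have main : \int[P]_w (\1_(shell k D1 D2 g) w / 2 + \sum_i (H1 i w + H2 i w)) <=
    \int[P]_w ((2^-1 * c + (2 * c)^-1 * trunc_fluct P xi e w) +
      (enorm (W w) * (D1 w + D2 w) + (g + 3 * e) * enorm (W w) +
       \sum_i (enorm (xi i w) * `|D1 w - D1i i w| +
               enorm (xi i w) * `|D2 w - D2i i w|))).
  apply: le_Rintegral => //; first exact: L1D.
  move=> w _.
  have -> : 2^-1 * c + (2 * c)^-1 * trunc_fluct P xi e w =
      (c + trunc_fluct P xi e w / c) / 2 by field; rewrite gt_eqF.
  apply: shell_pointwise => //; first exact: ltW.
  - exact: le0 D1m _.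
  - exact: le0 D2m _.
  - by move=> i; exact: le0 (D2im i) _.
  - by rewrite /e ler_pM2l.
move: main.
rewrite (RintegralD measurableT Z2L1 WsL1).
rewrite (RintegralD measurableT SL1 (L1_sum _ (fun i _ => HL1 i))).
rewrite (Rintegral_sum _ (fun i _ => HL1 i)) big1 ?addr0; last first.
  move=> i _; have [h1 z1] := H1P i; have [h2 z2] := H2P i.
  by rewrite RintegralD// z1 z2 addr0.
have -> : \int[P]_w (\1_(shell k D1 D2 g) w / 2) = fine (P (shell k D1 D2 g)) / 2.
  rewrite RintegralZr//; last exact: integrable_indic.
  by rewrite /Rintegral integral_indic// setIT.
have -> : \int[P]_w (2^-1 * c + (2 * c)^-1 * trunc_fluct P xi e w) =
    2^-1 * c + (2 * c)^-1 * \int[P]_w trunc_fluct P xi e w.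
  rewrite (RintegralD measurableT (L1_cst P (2^-1 * c)) (L1Zl (2 * c)^-1 ZL1)).
  by rewrite Rintegral_probability_cst (RintegralZl _ measurableT ZL1).
have gWL1 := L1Zl (g + 3 * e) WL1.
rewrite (RintegralD measurableT W2L1 sDL1) (RintegralD measurableT WDL1 gWL1).
rewrite (RintegralZl _ measurableT WL1) (Rintegral_sum _ (fun i _ => DL1 i)).
rewrite (eq_bigr _ (fun i _ => RintegralD measurableT
  (xDL1 i _ _ mD1 (mD1i i) D1m (D1im i)) (xDL1 i _ _ mD2 (mD2i i) D2m (D2im i)))).
set J := \sum_i _.
have Z2 : (2 * c)^-1 * \int[P]_w trunc_fluct P xi e w <= e * q / 2.
  rewrite ler_pdivrMl; last by rewrite mulr_gt0.
  apply: le_trans Zle _.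
  have <- : q ^+ 2 = d%:R by rewrite sqr_sqrtr.
  by rewrite /c; lra.
have W3 : (g + 3 * e) * \int[P]_w enorm (W w) <= (g + 3 * e) * q.
  by rewrite ler_wpM2l// /e; lra.
move: Z2 W3; rewrite -/q /c /e; lra.
Qed.

End shell_concentration.

(** * Reduction of the theorem to bounded variables *)

Section parallel_set_lemmas.
Context {R : realType} {d : nat}.
Implicit Types (A : set 'rV[R]_d) (t : R) (x : 'rV[R]_d).

Lemma parallel_setT t x : parallel_set [set: 'rV[R]_d] t x.
Proof.
rewrite /parallel_set; case: ifPn => [t0|_]; last by case: ifPn.
apply: (@le_trans _ _ 0%E); last by rewrite lee_fin ltW.
by apply: ereal_inf_lbound; exists x => //; rewrite subrr enorm0.
Qed.

Lemma inradius_gt0_nonempty A : (0 < inradius (closure A))%E -> A !=set0.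
Proof.
move=> /ereal_sup_gt[_ [y [y0 [x xA] _] _]].
have /closure_enormP/(_ 1 ltr01)[a Aa _] : closure A x.
  by apply: xA; rewrite /eball /= subrr enorm0.
by exists a.
Qed.

End parallel_set_lemmas.

Section truncation.
Context {R : realType}.
Implicit Types D E N : R.

(** Clipping at [N] makes all integrands integrable; clipping at 0 is for the leave-one-out
    variables, which may be negative. Being 1-Lipschitz, [clip] does not increase |D - E|. *)
Definition clip N D : R := Num.max 0 (Num.min D N).

Lemma clip_bounds N D : 0 <= N -> 0 <= clip N D <= N.
Proof. by move=> N0; rewrite /clip le_max lexx /= ge_max N0 ge_min lexx orbT. Qed.

Lemma clip_id N D : 0 <= D <= N -> clip N D = D.
Proof. by move=> /andP[D0 DN]; rewrite /clip min_l// max_r. Qed.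

Lemma clip_le N D : 0 <= D -> clip N D <= D.
Proof. by move=> D0; rewrite /clip ge_max D0 ge_min lexx. Qed.

Lemma clip_lip N D E : `|clip N D - clip N E| <= `|D - E|.
Proof.
have h1 := ler_norm (D - E); have h2 := ler_norm (E - D).
rewrite (distrC E D) in h2; move: `|D - E| h1 h2 => a h1 h2.
rewrite /clip ler_norml /Num.max; case: (leP D N) => ?; case: (leP E N) => ?;
  by case: (ltP 0 D) => ?; case: (ltP 0 E) => ?; case: (ltP 0 N) => ?; lra.
Qed.

Lemma measurable_clip N : measurable_fun [set: R] (clip N).
Proof. by apply: measurable_maxr => //; exact: measurable_minr. Qed.

End truncation.

Lemma leave_one_out_clip (disp : measure_display) (T : measurableType disp)
    (R : realType) (P : probability T R) (d : nat) (D : T -> R)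
    (V x : T -> 'rV[R]_d) (N : R) :
  leave_one_out_independent P D V x ->
  leave_one_out_independent P (clip N \o D) V x.
Proof.
move=> DVx.
have m : measurable_fun [set: (R * borel_rV R d)%type]
    (fun p : (R * borel_rV R d)%type => (clip N p.1, p.2)).
  apply: measurable_fun_pair => //.
  exact: (measurableT_comp (measurable_clip N)).
exact: (independent2_comp m (@measurable_id _ _ setT) DVx).
Qed.

Theorem proposition4p1 (R : realType) (disp : measure_display)
    (T : measurableType disp) (P : probability T R) (d n : nat)
    (xi : 'I_n -> T -> 'rV[R]_d)
    (xi_random : forall i, random_vector (xi i))
    (xi_indep :
      mutually_independent P (xi : 'I_n -> T -> borel_rV R d))
    (xi_centered : forall (i : 'I_n) (k : 'I_d),
      ('E_P[fun w => xi i w ord0 k] = 0)%E)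
    (xi_cov : forall k l : 'I_d,
      (\sum_(i < n) 'E_P[fun w => ((xi i w)^T *m xi i w)%R k l]
       = ((1%:M : 'M[R]_d) k l)%:E)%E)
    (Delta1 Delta2 : {RV P >-> R})
    (Delta1_ge0 : forall w, 0 <= Delta1 w)
    (Delta2_ge0 : forall w, 0 <= Delta2 w)
    (Delta1i Delta2i : 'I_n -> {RV P >-> R}) :
  let W : T -> 'rV[R]_d := fun w => \sum_(i < n) xi i w in
  let gamma : \bar R := (\sum_(i < n) 'E_P[fun w => (enorm (xi i w) ^+ 3)%R])%E in
  let g : R := fine gamma in
  (forall i, leave_one_out_independent P
               (Delta1i i) (fun w => W w - xi i w) (xi i)) ->
  (forall i, leave_one_out_independent P
               (Delta2i i) (fun w => W w - xi i w) (xi i)) ->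
  forall A : set 'rV[R]_d, convex_set A ->
  let Delta2bar : T -> R :=
    fun w => fine (mine (Delta2 w)%:E (inradius (closure A) - gamma))%E in
  (gamma < inradius (closure A))%E ->
  (outer_prob P [set w | (parallel_set A (4 * g + Delta1 w)
                          `\` parallel_set A (4 * g - Delta2bar w)) (W w)]
   <= (19 * Num.sqrt d%:R)%:E * gamma
      + 2%:E * 'E_P[fun w => (enorm (W w) * (Delta1 w + Delta2 w))%R]
      + 2%:E * \sum_(i < n)
          ('E_P[fun w => (enorm (xi i w) * `|Delta1 w - Delta1i i w|)%R]
           + 'E_P[fun w => (enorm (xi i w) * `|Delta2 w - Delta2i i w|)%R]))%E.
Proof.
move=> W gamma g ind1 ind2 A cA Delta2bar gammaA.
have gamma0 : (0 <= gamma)%E.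
  by apply: sume_ge0 => i _; apply: expectation_ge0 => w; rewrite exprn_ge0 ?enorm_ge0.
have RHS0 : (0 <= (19 * Num.sqrt d%:R)%:E * gamma
    + 2%:E * 'E_P[fun w => (enorm (W w) * (Delta1 w + Delta2 w))%R]
    + 2%:E * \sum_(i < n)
        ('E_P[fun w => (enorm (xi i w) * `|Delta1 w - Delta1i i w|)%R]
         + 'E_P[fun w => (enorm (xi i w) * `|Delta2 w - Delta2i i w|)%R]))%E.
  apply: adde_ge0; first apply: adde_ge0.
  - by rewrite mule_ge0// lee_fin mulr_ge0.
  - rewrite mule_ge0//; apply: expectation_ge0 => w.
    by rewrite mulr_ge0 ?enorm_ge0// addr_ge0.
  - rewrite mule_ge0//; apply: sume_ge0 => i _.
    by apply: adde_ge0; apply: expectation_ge0 => w; rewrite mulr_ge0 ?enorm_ge0.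
(* The whole space has no supporting half-space; its shell is empty. *)
have [AT|AT] := eqVneq A setT.
  rewrite [X in outer_prob P X](_ : _ = set0); last first.
    by apply/seteqP; split=> // w [_]; rewrite AT; case; exact: parallel_setT.
  by rewrite /outer_prob mu_ext0.
have A0 : A !=set0 by apply: inradius_gt0_nonempty; exact: le_lt_trans gammaA.
(* In dimension 0 a nonempty set is the whole space, just excluded. Positivity of [d] makes [g]
   positive below. *)
have d0 : (0 < d)%N.
  rewrite lt0n; apply/eqP => d_eq0; case/eqP: AT; rewrite -subTset => x _.
  case: A0 => a Aa; suff -> : x = a by [].
  apply/rowP => k; have := leq_ltn_trans (leq0n k) (ltn_ord k) => d0.
  by rewrite d_eq0 in d0.
have gammafin : gamma \is a fin_num.
  by rewrite ge0_fin_numE//; exact: lt_le_trans gammaA (leey _).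
have gammaE : gamma = g%:E by rewrite /g fineK.
have mxi i : coord_measurable (xi i) by exact: random_vector_coord.
have mW : coord_measurable W by exact: coord_measurable_sum.
have mcube i : measurable_fun [set: T] (fun w => enorm (xi i w) ^+ 3).
  by apply: measurable_funX; exact: measurable_enorm.
have cube i : L1_rv P (fun w => enorm (xi i w) ^+ 3).
  apply/integrableP; split; first exact/measurable_EFinP.
  have : ('E_P[fun w => (enorm (xi i w) ^+ 3)%R] \is a fin_num)%E.
    by move: gammafin => /sum_fin_numP/(_ i (mem_index_enum _) isT).
  rewrite ge0_fin_numE; last first.
    by apply: expectation_ge0 => w; rewrite exprn_ge0 ?enorm_ge0.
  rewrite unlock; apply: le_lt_trans; rewrite le_eqVlt; apply/orP; left; apply/eqP.
  by apply: eq_integral => w _ /=; rewrite ger0_norm// exprn_ge0 ?enorm_ge0.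
have centered i k : \int[P]_w (xi i w ord0 k) = 0.
  apply: EFin_inj; rewrite -expectation_Rintegral ?xi_centered//.
  exact: L1_coord.
have cov k l : \sum_i \int[P]_w (xi i w ord0 k * xi i w ord0 l) = (k == l)%:R.
  have := xi_cov k l; rewrite mxE => h; apply: EFin_inj; rewrite -h -sumEFin.
  apply: eq_bigr => i _; rewrite -expectation_Rintegral; last exact: L1_coord_mul.
  congr expectation; apply/funext => w.
  by rewrite mxE big_ord1 mxE.
have gsum : \sum_i \int[P]_w (enorm (xi i w) ^+ 3) = g.
  apply: EFin_inj; rewrite -gammaE -sumEFin; apply: eq_bigr => i _.
  by rewrite -expectation_Rintegral.
have gle : \sum_i \int[P]_w (enorm (xi i w) ^+ 3) <= g by rewrite gsum.
have g0 : 0 < g by rewrite -gsum; exact: sum_Rintegral_cube_gt0.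
have [u [s [u1 us far]]] := exists_halfspace_family cA A0 AT g0.
(* Translating the half-spaces absorbs the offset 4 gamma: on the event the maximum relative to [s']
   lies between -(Delta2 + g), the [g] being the slack of the family, and Delta1. *)
pose s' j := s j + 4 * g.
have Delta2barle w : Delta2bar w <= Delta2 w.
  rewrite /Delta2bar gammaE; move: gammaA; rewrite gammaE.
  case: (inradius (closure A)) => [r| |]//= gr.
    by rewrite /mine; case: ltP => //=; rewrite lee_fin.
  by rewrite min_l// leey.
(* Measurable sets that cover the possibly nonmeasurable event. The upper bound is imposed for all
   [j], the lower one on the maximum of the first N + 1 forms, so that the sets increase with [N].
   The same [N] bounds the Deltas, so clipping leaves them unchanged on [E N]. *)
pose E (N : nat) := (\bigcap_j [set w | affine_form u s' j (W w) <= Delta1 w]) `&`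
  [set w | - (Delta2 w + g) <= affine_max u s' N (W w)] `&`
  ([set w | Delta1 w <= N%:R] `&` [set w | Delta2 w <= N%:R]).
have mle (X Y : T -> R) : measurable_fun [set: T] X -> measurable_fun [set: T] Y ->
    measurable [set w | X w <= Y w].
  move=> mX mY; have := measurable_fun_ler mX mY measurableT (Y := [set true]) I.
  by rewrite setTI.
have mE N : measurable (E N).
  apply: measurableI; first apply: measurableI.
  - apply: bigcapT_measurable => j; apply: mle => //.
    exact: measurable_affine_form.
  - apply: mle; last exact: measurable_affine_max.
    by apply: measurable_funN; exact: measurable_funD.
  - by apply: measurableI; exact: mle.
have mUE : measurable (\bigcup_N E N) by exact: bigcup_measurable.
have sub : [set w | (parallel_set A (4 * g + Delta1 w)
    `\` parallel_set A (4 * g - Delta2bar w)) (W w)] `<=` \bigcup_N E N.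
  move=> w [/= inA /far[j jfar]].
  pose N := maxn j (maxn (Num.bound (Delta1 w)) (Num.bound (Delta2 w))).
  exists N => //; split; [split|split] => /=.
  - move=> i _ /=; rewrite /affine_form /s'.
    have t0 : 0 < 4 * g + Delta1 w by rewrite ltr_wpDr// mulr_gt0.
    have := dotv_le_parallel_set (u1 i) (us i) t0 inA; lra.
  - apply: (@le_trans _ _ (affine_form u s' j (W w))).
      rewrite /affine_form /s'; have := Delta2barle w; lra.
    by apply: le_affine_max; rewrite leq_maxl.
  - apply/ltW/(lt_le_trans (archi_boundP (Delta1_ge0 w))).
    by rewrite ler_nat /N !leq_max leqnn orbT.
  - apply/ltW/(lt_le_trans (archi_boundP (Delta2_ge0 w))).
    by rewrite ler_nat /N !leq_max leqnn !orbT.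
apply: (@le_trans _ _ (P (\bigcup_N E N))).
  by rewrite /outer_prob -(measurable_mu_extE P mUE); exact: le_mu_ext.
have ndE : {homo E : N M / (N <= M)%N >-> (N <= M)%O}.
  move=> N M NM; apply/subsetPset => w [[wA wN] [w1 w2]].
  split; [split|split] => //=.
  - exact: le_trans wN (affine_max_homo _ _ _ NM).
  - by apply: le_trans w1 _; rewrite ler_nat.
  - by apply: le_trans w2 _; rewrite ler_nat.
have cvgE := nondecreasing_cvg_mu (mu := P) mE mUE ndE.
rewrite -(cvg_lim _ cvgE)//; apply: lime_le.
  by apply/cvg_ex; eexists; exact: cvgE.
apply: nearW => N /=.
pose D1 := clip N%:R \o Delta1; pose D2 := clip N%:R \o Delta2.
pose D1i i := clip N%:R \o Delta1i i; pose D2i i := clip N%:R \o Delta2i i.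
have mclip (X : {RV P >-> R}) : measurable_fun [set: T] (clip N%:R \o X).
  exact: (measurableT_comp (measurable_clip N%:R)).
have bclip (X : T -> R) w : 0 <= (clip N%:R \o X) w <= N%:R by exact: clip_bounds.
have mS : measurable (shell xi u s' N D1 D2 g).
  by apply: measurable_shell => //; exact: mclip.
have ES : (P (E N) <= P (shell xi u s' N D1 D2 g))%E.
  apply: le_measure; rewrite ?inE// => w [[wA wN] [w1 w2]].
  rewrite /shell /D1 /D2 /= !clip_id ?Delta1_ge0 ?Delta2_ge0//.
  rewrite -/(W w) wN /=; apply: affine_max_le => j; exact: wA.
apply: le_trans ES _.
have Pfin : P (shell xi u s' N D1 D2 g) \is a fin_num by exact: fin_num_measure.
rewrite -(fineK Pfin).
have conc := shell_concentration xi_random xi_indep centered cov cube s' u1 N d0 g0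
  gle (mclip Delta1) (mclip Delta2) (fun i => mclip (Delta1i i))
  (fun i => mclip (Delta2i i)) (bclip Delta1) (bclip Delta2)
  (fun i => bclip (Delta1i i)) (fun i => bclip (Delta2i i))
  (fun i => leave_one_out_clip N%:R (ind1 i))
  (fun i => leave_one_out_clip N%:R (ind2 i)).
move: conc; rewrite -lee_fin => /le_trans; apply.
rewrite !EFinD; apply: leeD; first apply: leeD.
(* Here 18 is relaxed to 19. *)
- rewrite gammaE -EFinM lee_fin; apply: ler_wpM2r; first exact: ltW.
  by apply: ler_wpM2r => //; rewrite ler_nat.
- rewrite EFinM; apply: lee_wpmul2l => //; apply: EFin_Rintegral_le_expectation.
  + apply: measurable_funM; first exact: measurable_enorm.
    by apply: measurable_funD; exact: mclip.
  + apply: measurable_funM; first exact: measurable_enorm.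
    exact: measurable_funD.
  + move=> w; rewrite ler_wpM2l ?enorm_ge0 ?lerD ?clip_le// andbT.
    have /andP[c1 _] := bclip Delta1 w; have /andP[c2 _] := bclip Delta2 w.
    by rewrite mulr_ge0 ?enorm_ge0// addr_ge0.
- rewrite EFinM; apply: lee_wpmul2l => //; rewrite -sumEFin.
  have term (i : 'I_n) (X Y : {RV P >-> R}) :
      ((\int[P]_w (enorm (xi i w) * `|(clip N%:R \o X) w - (clip N%:R \o Y) w|))%:E
       <= 'E_P[fun w => (enorm (xi i w) * `|X w - Y w|)%R])%E.
    apply: EFin_Rintegral_le_expectation.
    + apply: measurable_funM; first exact: measurable_enorm.
      by apply: measurableT_comp => //; apply: measurable_funB; exact: mclip.
    + apply: measurable_funM; first exact: measurable_enorm.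
      by apply: measurableT_comp => //; exact: measurable_funB.
    + move=> w; rewrite mulr_ge0 ?enorm_ge0//= ler_wpM2l ?enorm_ge0//.
      exact: clip_lip.
  by apply: lee_sum => i _; rewrite EFinD; apply: leeD; exact: term.
Qed.
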